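(* Let $\mathcal{L},\mathcal{L}'\subseteq\mathbb{S}^n$ be Jordan spaces of the same dimension $m$ that are embeddings of unital Jordan algebras $\mathcal{A},\mathcal{A}'$, respectively. If $\mathcal{L}$ degenerates to $\mathcal{L}'$ (as Jordan spaces), then $\mathcal{A}$ degenerates to $\mathcal{A}'$ (as abstract Jordan algebras).
   Context: $\mathbb{S}^n$ is the space of complex symmetric $n\times n$ matrices. A (unital) Jordan algebra is a complex vector space with a symmetric bilinear product satisfying $(x\cdot x)\cdot(x\cdot y)=x\cdot((x\cdot x)\cdot y)$ for all $x,y$ and having a unit; morphisms are linear maps preserving products and units. For an invertible $U\in\mathbb{S}^n$, the product $X\bullet_U Y=\frac12(XU^{-1}Y+YU^{-1}X)$ makes $\mathbb{S}^n$ a unital Jordan algebra with unit $U$. An embedding of $\mathcal{A}$ into $\mathbb{S}^n$ is the image of an injective morphism of unital Jordan algebras $\mathcal{A}\to(\mathbb{S}^n,\bullet_U)$ for some invertible $U\in\mathbb{S}^n$; a Jordan space is an embedding of some Jordan algebra. Degeneration of Jordan spaces: if $\mathcal{L},\mathcal{L}'\subseteq\mathbb{S}^n$ are Jordan spaces of dimension $m$ with bases $X_1,\dots,X_m$ and $X_1',\dots,X_m'$, then $\mathcal{L}$ degenerates to $\mathcal{L}'$ if there exist $P\in\mathrm{GL}_n(\mathbb{C}[t^{\pm1}])$ and $Q\in\mathrm{GL}_m(\mathbb{C}[t^{\pm1}])$ such that the entries of $(Y_1,\dots,Y_m):=(PX_1P^\top,\dots,PX_mP^\top)Q$ are matrices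 with coefficients in $\mathbb{C}[t]$ and $X_i'=\lim_{t\to0}Y_i$ for all $i$. Degeneration of abstract Jordan algebras: the space $\mathrm{Jord}_m\subseteq\mathbb{C}^{m\times m\times m}$ consists of the structure constants $(c_i^{j_1,j_2})$ defining (via $x_{j_1}\cdot x_{j_2}=\sum_i c_i^{j_1,j_2}x_i$) a Jordan algebra structure on an $m$-dimensional space with basis $x_1,\dots,x_m$; $\mathrm{GL}_m$ acts by base change, and orbits are isomorphism classes. $\mathcal{A}$ degenerates to $\mathcal{B}$ if there is $g(t)\in\mathrm{GL}_m(\mathbb{C}[t^{\pm1}])$ with $\mathcal{B}=\lim_{t\to0}g(t)\cdot\mathcal{A}$; equivalently, $\mathcal{B}$ lies in the closure of the orbit of $\mathcal{A}$. *)

(* Defs.v *)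
From HB Require Import structures.
From mathcomp Require Import all_boot all_order all_algebra complex.
From mathcomp Require Import all_classical all_reals all_analysis.
Import numFieldNormedType.Exports.

Set Implicit Arguments.
Unset Strict Implicit.
Unset Printing Implicit Defensive.

Import GRing.Theory.
Local Open Scope classical_set_scope.
Local Open Scope ring_scope.

(* Unital Jordan algebras over a field, on a finite-dimensional carrier.     *)
(* Linearity in the second argument follows from [jmulC].                    *)
HB.mixin Record Vector_isJordan (K : fieldType) (V : Type) of Vector K V := {
  jmul : V -> V -> V;
  jone : V;
  jmulC : commutative jmul;
  jmul_linearl : forall y, linear (jmul^~ y);
  jmul_jordan : forall x y,
    jmul (jmul x x) (jmul x y) = jmul x (jmul (jmul x x) y);
  jmul1 : left_id jone jmul
}.

#[short(type="jordanType")]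
HB.structure Definition Jordan (K : fieldType) :=
  {V of Vector_isJordan K V & Vector K V}.

Section JordanSpaces.
Variables (K : fieldType) (n : nat).

Definition jordan_prod (U X Y : 'M[K]_n) : 'M[K]_n :=
  2^-1 *: (X *m invmx U *m Y + Y *m invmx U *m X).

Definition jordan_embedding (A : jordanType K) (L : {vspace 'M[K]_n}) : Prop :=
  exists U : 'M[K]_n, exists phi : 'Hom(A, 'M[K]_n),
    [/\ U^T = U /\ U \in unitmx,
        lker phi == 0%VS,
        (forall x, (phi x)^T = phi x) /\ phi jone = U,
        forall x y, phi (jmul x y) = jordan_prod U (phi x) (phi y)
      & L = limg phi].

End JordanSpaces.

(* Laurent polynomials over C are the elements p / X^k of the field of       *)
(* rational functions.                                                       *)
Section Laurent.
Variable C : numFieldType.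
Local Notation ratfun := {fraction {poly C}}.

Definition ratfun_poly (p : {poly C}) : ratfun := FracField.tofrac p.
Definition ratfun_const (c : C) : ratfun := ratfun_poly c%:P.

Definition polynomial (f : ratfun) : Prop :=
  exists p : {poly C}, f = ratfun_poly p.

Definition laurent (f : ratfun) : Prop :=
  exists (p : {poly C}) (k : nat), f = ratfun_poly p / ratfun_poly 'X^k.

(* f is a Laurent polynomial whose values f(t) tend to l as t -> 0, t != 0.  *)
Definition laurent_cvg0 (f : ratfun) (l : C) : Prop :=
  exists (p : {poly C}) (k : nat),
    f = ratfun_poly p / ratfun_poly 'X^k /\
    p.[t] / t ^+ k @[t --> (0 : C)^'] --> l.

(* Invertibility in the ring of d x d Laurent matrices: the inverse matrix   *)
(* must have Laurent entries as well.                                        *)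
Definition laurent_GL (d : nat) (P : 'M[ratfun]_d) : Prop :=
  [/\ P \in unitmx,
      forall i j, laurent (P i j)
    & forall i j, laurent (invmx P i j)].

End Laurent.

Section Degenerations.
Variable C : numFieldType.
Local Notation ratfun := {fraction {poly C}}.

(* Bases are chosen existentially: a constant change of basis on either side *)
(* can be absorbed into Q.                                                   *)
Definition jordan_space_degenerates (n m : nat) (L L' : {vspace 'M[C]_n}) :
    Prop :=
  exists X X' : m.-tuple 'M[C]_n,
    [/\ basis_of L X, basis_of L' X' &
    exists (P : 'M[ratfun]_n) (Q : 'M[ratfun]_m),
      [/\ laurent_GL P, laurent_GL Q &
      forall i : 'I_m,
        let Y := \sum_(k < m)
          Q k i *: (P *m map_mx (@ratfun_const C) (tnth X k) *m P^T) in
        forall a b : 'I_n,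
          polynomial (Y a b) /\ laurent_cvg0 (Y a b) (tnth X' i a b)]].

(* [c i j1 j2] is the coefficient c_i^{j1,j2} of x_i in x_j1 . x_j2.         *)
Definition structure_constants (m : nat) (A : jordanType C)
    (x : m.-tuple A) (i j1 j2 : 'I_m) : C :=
  coord x i (jmul (tnth x j1) (tnth x j2)).

(* The product (u, v) |-> g (g^-1 u . g^-1 v) on column vectors.             *)
Definition base_change (F : fieldType) (m : nat) (g : 'M[F]_m)
    (c : 'I_m -> 'I_m -> 'I_m -> F) (i j1 j2 : 'I_m) : F :=
  \sum_(k < m) \sum_(l1 < m) \sum_(l2 < m)
    g i k * c k l1 l2 * invmx g l1 j1 * invmx g l2 j2.

Definition structure_degenerates (m : nat) (c c' : 'I_m -> 'I_m -> 'I_m -> C) :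
    Prop :=
  exists g : 'M[ratfun]_m, laurent_GL g /\
    forall i j1 j2,
      laurent_cvg0
        (base_change g (fun k l1 l2 => ratfun_const (c k l1 l2)) i j1 j2)
        (c' i j1 j2).

(* As above, a constant change of basis can be absorbed into g.              *)
Definition jordan_algebra_degenerates (m : nat) (A B : jordanType C) : Prop :=
  exists (x : m.-tuple A) (y : m.-tuple B),
    [/\ basis_of fullv x, basis_of fullv y &
        structure_degenerates (structure_constants x) (structure_constants y)].

End Degenerations.

(* Main.v *)
Require Import Defs.
From HB Require Import structures.
From mathcomp Require Import all_boot all_order all_algebra complex.
From mathcomp Require Import all_field generic_quotient.
From mathcomp Require Import all_classical all_reals all_analysis.
From mathcomp Require Import ring zify.

(** Over the function field C(t) the degeneration matrices P and Q turn the basis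
X of L into a family Y with Y(0) = X'.  Let u' be the coordinates of the unit
U' of L' in the basis X', and put V0 = sum_i u'_i Y_i.  Then V0(0) = U' is
invertible, so the products of the Y_i for the unit V0 are regular at t = 0,
and their structure constants specialize at 0 to those of A'.  It remains to
see that these structure constants over C(t) are a base change of those of A,
and to choose the base change with Laurent polynomial entries.

The first point is that isotopes are isomorphic over a large enough field.
The element V = P^-1 V0 P^-T lies in the span of X.  If M = V U^-1 has a
square root S that is a polynomial in M, then X |-> S X S^T maps the span of X
to itself (it is a quadratic operator of the Jordan algebra) and carries the
product with unit U to the product with unit V ([isotope_isomorphic]).  Such an
S exists as soon as the eigenvalues of M are nonzero squares ([mx_sqrt]).  In
general they are not squares of elements of C(t), and a ramified extension
has to be made.

This is done without Puiseux series.  A discrete place of a field E is encoded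
by the graph of its residue map, a partial map from E to C, together with a
uniformizer.  By Zorn's lemma the place t = 0 extends to a valuation ring of
any extension of C(t) with residue field still C, because a maximal graph is a
valuation ring when C is algebraically closed ([maximal_valuation]).  For a
finite extension it is again discrete, since every value, multiplied by a fixed
factorial, becomes a multiple of the value of the old uniformizer
([place_extend]).  Adjoining roots one at a time yields a field E with a
uniformizer s where the characteristic polynomial of M splits into factors
X - b^2 ([square_splitting]).

The second point is the decomposition of an invertible matrix h over E as
h = k g(s), with g an invertible matrix of Laurent polynomials and k a matrix
over the valuation ring that reduces to the identity
([laurent_decomposition]).  Applied to the matrix h of the isomorphism, it
replaces the basis Y by a basis with the same residues X', for which the base
change matrix is g(s).  The base change by g of the structure constants of A
is then a Laurent polynomial whose value at s is integral, hence a polynomial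
in s, and its value at 0 is the family of structure constants of A'. *)

Set Implicit Arguments.
Unset Strict Implicit.
Unset Printing Implicit Defensive.
Import Order.TTheory GRing.Theory Num.Theory.
Import numFieldNormedType.Exports.
Local Open Scope ring_scope.

(** * Partial places of a field over a field of constants *)

(** [res x a] reads: x is integral with residue a.  Keeping the residue map
as a graph makes the domain part of the data, so that graphs can be compared by
inclusion and extended by Zorn's lemma.  Excluding the pair (0, 1) is what
makes the graph functional. *)
Record partial_place (C E : fieldType) (iota : C -> E) (res : E -> C -> Prop)
    : Prop := PartialPlace {
  pp_const : forall c, res (iota c) c;
  pp_sub : forall x y a b, res x a -> res y b -> res (x - y) (a - b);
  pp_mul : forall x y a b, res x a -> res y b -> res (x * y) (a * b);
  pp_01 : ~ res 0 1 }.

Section PartialPlace.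
Variables (C E : fieldType) (iota : {rmorphism C -> E}) (res : E -> C -> Prop).
Hypothesis pp : partial_place iota res.

Lemma res_const c : res (iota c) c. Proof. exact: pp_const pp c. Qed.

Lemma resB x y a b : res x a -> res y b -> res (x - y) (a - b).
Proof. exact: pp_sub pp x y a b. Qed.

Lemma resM x y a b : res x a -> res y b -> res (x * y) (a * b).
Proof. exact: pp_mul pp x y a b. Qed.

Lemma res01 : ~ res 0 1. Proof. exact: pp_01 pp. Qed.

Lemma res1 : res 1 1.
Proof. by rewrite -{1}(rmorph1 iota); exact: res_const. Qed.

Lemma res0 : res 0 0.
Proof. by have := resB res1 res1; rewrite !subrr. Qed.

Lemma resN x a : res x a -> res (- x) (- a).
Proof. by move=> /(resB res0); rewrite !sub0r. Qed.

Lemma resD x y a b : res x a -> res y b -> res (x + y) (a + b).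
Proof. by move=> rx /resN /(resB rx); rewrite !opprK. Qed.

Lemma res_sum (I : Type) (r : seq I) (P : pred I) (f : I -> E) (g : I -> C) :
  (forall i, P i -> res (f i) (g i)) ->
  res (\sum_(i <- r | P i) f i) (\sum_(i <- r | P i) g i).
Proof. by move=> fg; apply: big_ind2 => //; [exact: res0|move=> x a y b;
  exact: resD]. Qed.

Lemma res_prod (I : Type) (r : seq I) (P : pred I) (f : I -> E) (g : I -> C) :
  (forall i, P i -> res (f i) (g i)) ->
  res (\prod_(i <- r | P i) f i) (\prod_(i <- r | P i) g i).
Proof. by move=> fg; apply: big_ind2 => //; [exact: res1|move=> x a y b;
  exact: resM]. Qed.

Lemma resX n x a : res x a -> res (x ^+ n) (a ^+ n).
Proof.
by move=> rx; elim: n => [|n IH]; [exact: res1|rewrite !exprS; exact: resM].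
Qed.

Lemma res0_eq0 a : res 0 a -> a = 0.
Proof.
move=> ra; apply/eqP; case: (eqVneq a 0) => // a0; case: (res01).
by have := resM (res_const a^-1) ra; rewrite mulr0 mulVf.
Qed.

Lemma res_fun x a b : res x a -> res x b -> a = b.
Proof.
by move=> ra /(resB ra); rewrite subrr => /res0_eq0 /eqP;
  rewrite subr_eq0 => /eqP.
Qed.

Lemma res_neq0 x a : res x a -> a != 0 -> x != 0.
Proof. by move=> ra; apply: contra_neq => x0; rewrite x0 in ra;
  apply: res0_eq0. Qed.

Definition res_poly (p : {poly E}) (q : {poly C}) := forall i, res p`_i q`_i.

Lemma res_polyM p q p' q' :
  res_poly p q -> res_poly p' q' -> res_poly (p * p') (q * q').
Proof.
by move=> pq pq' i; rewrite !coefM; apply: res_sum => j _; apply: resM.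
Qed.

Lemma res_polyB p q p' q' :
  res_poly p q -> res_poly p' q' -> res_poly (p - p') (q - q').
Proof. by move=> pq pq' i; rewrite !coefB; apply: resB. Qed.

Lemma res_polyC x a : res x a -> res_poly x%:P a%:P.
Proof. by move=> xa i; rewrite !coefC; case: eqP => // _; exact: res0. Qed.

Lemma res_polyX : res_poly 'X 'X.
Proof. by move=> i; rewrite !coefX; case: eqP => // _;
  [exact: res1|exact: res0]. Qed.

Lemma res_poly_map q : res_poly (map_poly iota q) q.
Proof. by move=> i; rewrite coef_map; exact: res_const. Qed.

(** Maximality is with respect to inclusion of graphs, so it covers both
a larger ring and the choice of residues on it. *)
Definition maximal_place :=
  forall res', partial_place iota res' -> (forall x a, res x a -> res' x a) ->
  forall x a, res' x a -> res x a.

Hypothesis max : maximal_place.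

(** Sending x to c extends the residue map to the ring generated by x
exactly when the relations satisfied by x reduce to polynomials that do not
take the value 1 at c; a maximal graph already contains every such extension. *)
Lemma maximal_adjoin x c :
  (forall p q, res_poly p q -> p.[x] = 0 -> q.[c] != 1) -> res x c.
Proof.
move=> xc.
pose res' y a := exists p q, [/\ res_poly p q, y = p.[x] & a = q.[c]].
apply: (max (res' := res')).
- split.
  + move=> a; exists (iota a)%:P, a%:P; rewrite !hornerC; split => //.
    by apply: res_polyC; exact: res_const.
  + move=> _ _ _ _ [p [q [pq -> ->]]] [p' [q' [pq' -> ->]]].
    by exists (p - p'), (q - q'); rewrite !hornerE; split => //;
      exact: res_polyB.
  + move=> _ _ _ _ [p [q [pq -> ->]]] [p' [q' [pq' -> ->]]].
    by exists (p * p'), (q * q'); rewrite !hornerE; split => //;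
      exact: res_polyM.
  + by move=> [p [q [pq /esym/(xc _ _ pq)/eqP + /esym]]].
- move=> y a ya; exists y%:P, a%:P; rewrite !hornerC; split => //.
  exact: res_polyC.
- by exists 'X, 'X; rewrite !hornerX; split => //; exact: res_polyX.
Qed.

(** A maximal domain is a local ring: a polynomial relation for the inverse
of u, multiplied by a power of u, becomes a relation between integral elements
whose residue is a power of a. *)
Lemma maximal_inv u a : res u a -> a != 0 -> res u^-1 a^-1.
Proof.
move=> ua a0; apply: maximal_adjoin => p q pq pu0.
apply/eqP => qa1; have u0 := res_neq0 ua a0.
pose N := maxn (size p) (size q).
have rev (F : fieldType) (r : {poly F}) (v : F) : v != 0 -> (size r <= N)%N ->
    r.[v^-1] * v ^+ N = \sum_(i < N) r`_i * v ^+ (N - i).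
  move=> v0 rN; rewrite (horner_coef_wide _ rN) mulr_suml;
    apply: eq_bigr => i _.
  have iN : (i <= N)%N by apply: ltnW.
  have -> : v ^+ N = v ^+ i * v ^+ (N - i) by rewrite -exprD subnKC.
  by rewrite exprVn -mulrA mulKf ?expf_neq0.
have := @res_sum _ (index_enum 'I_N) xpredT
  (fun i => p`_i * u ^+ (N - i)) (fun i => q`_i * a ^+ (N - i)).
rewrite -!rev ?leq_maxl ?leq_maxr // pu0 qa1 mul0r mul1r => H.
have /res0_eq0/eqP : res 0 (a ^+ N).
  by apply: H => i _; apply: resM => //; apply: resX.
by rewrite expf_eq0 (negPf a0) andbF.
Qed.

End PartialPlace.

(** * Maximal partial places are valuation rings *)

Section Valuation.
Variables (C : closedFieldType) (E : fieldType) (iota : {rmorphism C -> E}).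
Variable res : E -> C -> Prop.
Hypotheses (pp : partial_place iota res) (max : maximal_place iota res).

(** The residues of the relations of x form an ideal of C[X].  If it were
proper, its generator would have a root c, since C is algebraically closed, and
x could be adjoined with residue c. *)
Lemma maximal_unit_relation x :
  (forall a, ~ res x a) -> exists p, res_poly res p 1 /\ p.[x] = 0.
Proof.
move=> xdom.
pose I q := exists p, res_poly res p q /\ p.[x] = 0.
have I_unit c : exists q, I q /\ q.[c] = 1.
  apply: contrapT => nI; apply: (xdom c);
    apply: (maximal_adjoin pp max) => p q pq px.
  by apply/eqP => qc; apply: nI; exists q; split=> //; exists p.
have I_mul q r : I q -> I (q * r).
  move=> [p [pq px]]; exists (p * map_poly iota r); split.
    by apply: (res_polyM pp) => //; exact: res_poly_map pp r.
  by rewrite hornerM px mul0r.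
have I_sub q r : I q -> I r -> I (q - r).
  move=> [p [pq px]] [p' [pq' px']]; exists (p - p'); split.
    exact: (res_polyB pp).
  by rewrite !hornerE px px' subrr.
(* A nonzero element of I of least degree generates I. *)
pose D n := `[< exists q, [/\ I q, q != 0 & size q = n] >].
have exD : exists n, D n.
  have [q [Iq q0]] := I_unit 0; exists (size q); apply/asboolP; exists q.
  split => //; apply/eqP => qz; move: q0; rewrite qz horner0 => /esym/eqP.
  by rewrite oner_eq0.
case: (ex_minnP exD) => n /asboolP[q [Iq q0 sq]] nmin.
have [sq1|sqn1] := eqVneq (size q) 1.
  have := I_mul q (q`_0)^-1%:P Iq.
  rewrite {1}(size1_polyC (eq_leq sq1)) -polyCM divff //.
  by have := lead_coef_eq0 q; rewrite lead_coefE sq1 /= => ->.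
have [c /rootP qc] := closed_rootP _ sqn1.
have [r [Ir rc]] := I_unit c.
have [r0|r0] := eqVneq (r %% q) 0.
  move: rc; rewrite (divp_eq r q) r0 addr0 hornerM qc mulr0 => /esym/eqP.
  by rewrite oner_eq0.
have : (n <= size (r %% q)%R)%N.
  apply: nmin; apply/asboolP; exists (r %% q); split => //.
  have -> : r %% q = r - q * (r %/ q) by apply/esym/eqP;
    rewrite subr_eq addrC mulrC -divp_eq.
  exact/I_sub/I_mul.
by rewrite -sq leqNgt ltn_modp q0.
Qed.

(** The reversed polynomial of q vanishes at x and has a leading coefficient
of residue 1, while the leading coefficient of p has residue 0.  Eliminating
the latter lowers the degree of p and leaves its residue unchanged. *)
Lemma unit_relation_descent x n m p q :
    (0 < m <= n)%N -> x != 0 ->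
    res_poly res p 1 -> p.[x] = 0 -> (size p <= n)%N ->
    res_poly res q 1 -> q.[x^-1] = 0 -> (size q <= m)%N ->
  exists p', [/\ res_poly res p' 1, p'.[x] = 0 & (size p' <= n.-1)%N].
Proof.
case: n m => [|n] [|m] //=; rewrite ltnS => mn x0 p1 px sp q1 qx sq.
have q0 : res q`_0 1 by have := q1 0%N; rewrite coef1 eqxx.
have q00 : q`_0 != 0 := res_neq0 pp q0 (oner_neq0 _).
case: n => [|n] in mn sp *.
  case: (res01 pp); have := p1 0%N; rewrite coef1 eqxx.
  by move: px; rewrite (size1_polyC sp) hornerC coefC eqxx => ->.
pose qr := \poly_(i < m.+1) q`_(m - i).
have qrx : qr.[x] = 0.
  transitivity (q.[x^-1] * x ^+ m); last by rewrite qx mul0r.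
  rewrite (horner_coef_wide _ sq) horner_poly mulr_suml.
  rewrite (reindex_inj rev_ord_inj) /=; apply: eq_bigr => i _.
  have im : (i <= m)%N by rewrite -ltnS.
  rewrite subSS subKn // -mulrA; congr (_ * _).
  have -> : x ^+ m = x ^+ i * x ^+ (m - i) by rewrite -exprD subnKC.
  by rewrite exprVn mulKf ?expf_neq0.
exists (p - (p`_n.+1 / q`_0)%:P * 'X^(n.+1 - m) * qr); split.
- move=> i.
  rewrite coefB -mulrA coefCM coefXnM.
  rewrite -[(1 : {poly C})`_i]subr0; apply: (resB pp) => //.
  have pn0 : res (p`_n.+1 / q`_0) 0.
    have pn : res p`_n.+1 0 by have := p1 n.+1; rewrite coef1.
    have := resM pp pn (maximal_inv pp max q0 (oner_neq0 _)).
    by rewrite mul0r.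
  case: ifP => _; first by rewrite mulr0; exact: res0 pp.
  have [a ra] : exists a, res qr`_(i - (n.+1 - m)) a.
    rewrite coef_poly; case: ifP => _; first by eexists; exact: q1.
    by exists 0; exact: res0 pp.
  by have := resM pp pn0 ra; rewrite mul0r.
- by rewrite hornerD hornerN hornerM px qrx mulr0 subr0.
- apply/leq_sizeP => j; rewrite leq_eqVlt => /predU1P[<-|nj].
    rewrite coefB -mulrA coefCM coefXnM ltnNge leq_subr /= subKn //.
    by rewrite coef_poly ltnSn subnn divfK // subrr.
  rewrite coefB -mulrA coefCM coefXnM (nth_default _ (leq_trans sp nj)).
  case: ifP => _; first by rewrite mulr0 subrr.
  rewrite coef_poly ifF ?mulr0 ?subrr //; apply/negbTE; rewrite -leqNgt.
  by rewrite -(leq_add2r (n.+1 - m)) subnK ?addSn ?subnKC //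
    (leq_trans (leq_subr _ _)) // ltnW.
Qed.

(** If neither x nor its inverse were integral, both would satisfy a
relation with residue 1, and the descent, applied alternately to the two
relations, would never end. *)
Lemma maximal_valuation x : x != 0 ->
  (exists a, res x a) \/ (exists a, res x^-1 a).
Proof.
move=> x0; apply: contrapT => /not_orP[/forallNP xd /forallNP xVd].
have [p [p1 px]] := maximal_unit_relation xd.
have [q [q1 qx]] := maximal_unit_relation xVd.
have sz y r : res_poly res r 1 -> r.[y] = 0 -> (0 < size r)%N.
  move=> r1 ry; rewrite size_poly_gt0; apply/eqP => rz; apply: (res01 pp).
  by have := r1 0%N; rewrite rz coef0 coef1.
move: {2}(size p + size q)%N (leqnn (size p + size q)) => N.
elim: N => [|N IH] in x x0 xd xVd p q p1 px q1 qx *.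
  by rewrite leqn0 addn_eq0 => /andP[/eqP p0]; have := sz _ _ p1 px; rewrite p0.
wlog pq : x x0 xd xVd p q p1 px q1 qx / (size q <= size p)%N => [W|].
  have [/W H|/ltnW/W H] := leqP (size q) (size p); first by apply: (H x).
  by rewrite addnC; apply: (H x^-1); rewrite ?invr_eq0 ?invrK.
move=> H.
have qp : (0 < size q <= size p)%N by rewrite pq (sz _ _ q1 qx).
have [p' [p'1 p'x sp']] :=
  unit_relation_descent qp x0 p1 px (leqnn _) q1 qx (leqnn _).
apply: (IH x x0 xd xVd p' q) => //.
rewrite (leq_trans (n := (size p).-1 + size q)) ?leq_add2r //.
by rewrite -ltnS -addSn prednK // (sz _ _ p1 px).
Qed.

End Valuation.

Lemma maximal_place_exists (C E : fieldType) (iota : {rmorphism C -> E}) res0 :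
  partial_place iota res0 ->
  exists res, [/\ partial_place iota res, maximal_place iota res &
                forall x a, res0 x a -> res x a].
Proof.
move=> pp0.
pose graph (A : set (E * C)) x a := A (x, a).
(* The empty graph is admitted only as the union of the empty chain. *)
pose P A := A = set0 \/
  partial_place iota (graph A) /\ forall x a, res0 x a -> graph A x a.
have [|A [PA Amax]] := @Zorn_bigcup _ P.
  move=> F FP Ftot.
  have [[B [FB [x Bx]]]|none] := pselect (exists B, F B /\ exists x, B x);
    last first.
    left; apply/seteqP; split => // x [B FB Bx]; case: none.
    by exists B; split => //; exists x.
  have ppF D y : F D -> D y ->
      partial_place iota (graph D) /\ forall x a, res0 x a -> graph D x a.
    by move=> /FP [->|].
  have both D D' y y' : F D -> F D' -> D y -> D' y' ->
      exists D'', [/\ F D'', D'' y & D'' y'].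
    move=> FD FD' Dy Dy'.
    have [sub|sub] := Ftot _ _ FD FD'; first by exists D'; split=> //;
      exact: sub.
    by exists D; split => //; exact: sub.
  have [ppB subB] := ppF _ _ FB Bx.
  right; split; last by move=> y a /subB By; exists B.
  split.
  - by move=> c; exists B => //; exact: pp_const ppB c.
  - move=> y z a b [D FD Dy] [D' FD' D'z].
    have [D'' [FD'' y'' z'']] := both _ _ _ _ FD FD' Dy D'z.
    by exists D'' => //; exact: (pp_sub (ppF _ _ FD'' y'').1).
  - move=> y z a b [D FD Dy] [D' FD' D'z].
    have [D'' [FD'' y'' z'']] := both _ _ _ _ FD FD' Dy D'z.
    by exists D'' => //; exact: (pp_mul (ppF _ _ FD'' y'').1).
  - by move=> [D FD D01]; exact: (pp_01 (ppF _ _ FD D01).1 D01).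
have P0 : P [set u : E * C | res0 u.1 u.2]%classic by right; split.
case: PA => [A0|[ppA subA]].
  case: (Amax [set u : E * C | res0 u.1 u.2]%classic) => //; split;
    first by rewrite A0.
  by move=> /(_ (1, 1)); rewrite A0; apply; exact: res1 pp0.
exists (graph A); split => // res' pp' subA' x a x'a.
apply: contrapT => nAx; apply: (Amax [set u : E * C | res' u.1 u.2]%classic).
  split; first by move=> [y b]; exact: subA'.
  by move=> /(_ (x, a)) /(_ x'a).
by right; split => // y b /subA /subA'.
Qed.

(** * Units of a maximal partial place *)

Definition res_unit (C E : fieldType) (res : E -> C -> Prop) (u : E) :=
  exists2 a, res u a & a != 0.

(** A place with discrete valuation: s is a uniformizer, and the exponent k
in [place_val] is the valuation of x. *)
Record place (C E : fieldType) (iota : C -> E) (s : E) (res : E -> C -> Prop)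
    : Prop := Place {
  place_pp : partial_place iota res;
  unif_neq0 : s != 0;
  res_unif : res s 0;
  place_val : forall x, x != 0 ->
    exists k : int, res_unit res (x / s ^ k) }.

Section Extend.
Variables (C : closedFieldType) (E : fieldType) (iota : {rmorphism C -> E}).
Variables (res : E -> C -> Prop).
Hypotheses (pp : partial_place iota res) (max : maximal_place iota res).

Local Notation unit := (res_unit res).

Lemma res_unit1 : unit 1.
Proof. by exists 1; [exact: res1 pp|exact: oner_neq0]. Qed.

Lemma res_unitM x y : unit x -> unit y -> unit (x * y).
Proof. by move=> [a xa a0] [b yb b0]; exists (a * b);
  [exact: (resM pp)|exact: mulf_neq0]. Qed.

Lemma res_unitV x : unit x -> unit x^-1.
Proof. by move=> [a xa a0]; exists a^-1;
  [exact: maximal_inv pp max _ _ xa a0|rewrite invr_eq0]. Qed.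

Lemma res_unitX x n : unit x -> unit (x ^+ n).
Proof. by move=> ux; elim: n => [|n IH]; [exact: res_unit1|rewrite exprS;
  exact: res_unitM]. Qed.

Lemma res_unit_neq0 x : unit x -> x != 0.
Proof. by move=> [a /(res_neq0 pp)]. Qed.

Lemma res_unit_trichotomy x : x != 0 -> [\/ unit x, res x 0 | res x^-1 0].
Proof.
move=> x0; have [[a xa]|[a xa]] := maximal_valuation pp max x0.
  have [a0|a0] := eqVneq a 0; first by apply: Or32; rewrite -a0.
  by apply: Or31; exists a.
have [a0|a0] := eqVneq a 0; first by apply: Or33; rewrite -a0.
by apply: Or31; rewrite -[x]invrK; apply: res_unitV; exists a.
Qed.

Lemma nonunit_res0 x : res x 0 -> ~ unit x.
Proof. by move=> x0 [a /(res_fun pp x0) <-]; rewrite eqxx. Qed.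

(** A valuation ring is integrally closed. *)
Lemma res_unit_root x n : (0 < n)%N -> unit (x ^+ n) -> unit x.
Proof.
move=> n0 ux; have x0 : x != 0.
  by apply: contraTneq isT => x0; have := res_unit_neq0 ux;
    rewrite x0 expr0n gtn_eqF // eqxx.
have z y : res y 0 -> res (y ^+ n) 0.
  by move=> /(resX pp n); rewrite expr0n gtn_eqF.
have [//|/z/nonunit_res0//|/z] := res_unit_trichotomy x0.
by rewrite exprVn => /nonunit_res0; case; exact: res_unitV.
Qed.

(** In a sum of terms with pairwise distinct values, one term dominates and
the sum has the same value; in particular the sum is not zero. *)
Lemma sum_dominant_term (f : nat -> E) (r : seq nat) :
    r != [::] -> uniq r -> (forall i, i \in r -> f i != 0) ->
    (forall i j, i \in r -> j \in r -> i != j -> ~ unit (f i / f j)) ->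
  exists2 i, i \in r & unit ((\sum_(k <- r) f k) / f i).
Proof.
elim: r => // i r IH _ /= /andP[ir ur] f0 fu.
have fi0 : f i != 0 by apply: f0; rewrite mem_head.
rewrite big_cons.
have [->|rn] := eqVneq r [::].
  by exists i; rewrite ?mem_head // big_nil addr0 divff //; exact: res_unit1.
have [||j jr [a ha a0]] := IH rn ur.
- by move=> k kr; apply: f0; rewrite inE kr orbT.
- by move=> k l kr lr; apply: fu; rewrite inE ?kr ?lr orbT.
have jir : j \in i :: r by rewrite inE jr orbT.
have fj0 := f0 _ jir.
have ij : i != j by apply: contraNneq ir => ->.
have [||ltij|] := @res_unit_trichotomy (f i / f j).
- by rewrite mulf_neq0 ?invr_eq0.
- by move=> /fu; case=> //; exact: mem_head.
- exists j => //; exists a => //; rewrite mulrDl -[a]add0r.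
  exact: (resD pp).
rewrite invf_div => ltji; exists i; first exact: mem_head.
exists 1; last exact: oner_neq0.
rewrite mulrDl divff // -[1 in X in res _ X]addr0; apply: (resD pp);
  first exact: res1 pp.
have := resM pp ha ltji; rewrite mulr0 mulrA divfK //.
Qed.

(** In the vanishing sum p(x) two terms must have the same value, so some
power x^(i - l), with 0 < i - l <= d, has the value of an element of F.
The exponent d! is a common multiple of all i - l, whatever x is. *)
Lemma algebraic_val (F : fieldType) (j : {rmorphism F -> E}) (s : F)
    (resF : F -> C -> Prop) (iotaF : C -> F) (d : nat) (x : E) (p : {poly F}) :
    place iotaF s resF -> (forall y a, resF y a -> res (j y) a) ->
    x != 0 -> p != 0 -> (size p <= d.+1)%N -> root (map_poly j p) x ->
  exists k : int, unit (x ^+ d`! / j s ^ k).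
Proof.
move=> pl jres x0 p0 sp /rootP px.
pose f i := j p`_i * x ^+ i.
pose r := [seq i <- index_iota 0 d.+1 | p`_i != 0].
have f0 i : i \in r -> f i != 0.
  by rewrite mem_filter => /andP[pi _];
    rewrite mulf_neq0 ?fmorph_eq0 ?expf_neq0.
have sum0 : \sum_(k <- r) f k = 0.
  rewrite -[RHS]px (horner_coef_wide (n := d.+1)) ?size_map_poly //.
  rewrite big_filter -(big_mkord xpredT (fun i => (map_poly j p)`_i * x ^+ i)).
  rewrite big_mkcond /=; apply: eq_bigr => i _; rewrite coef_map /f.
  by have [->|_] := eqVneq p`_i 0; rewrite /= ?rmorph0 ?mul0r.
have [i [l [ir lr il ufil]]] :
    exists i l, [/\ i \in r, l \in r, (l < i)%N & unit (f i / f l)].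
  apply: contrapT => no.
  have [||||i ir] := @sum_dominant_term f r.
  - apply: contraNneq p0 => r0; rewrite -lead_coef_eq0 lead_coefE.
    apply: contraTT isT => pn; have : (size p).-1 \in r.
      rewrite mem_filter pn mem_index_iota /=.
      by rewrite -ltnS prednK ?ltnS // lt0n size_poly_eq0 -lead_coef_eq0.
    by rewrite r0.
  - by rewrite filter_uniq // iota_uniq.
  - exact: f0.
  - move=> i l ir lr il u; apply: no.
    move: il; rewrite neq_ltn => /orP[il|li]; last by exists i, l.
    by exists l, i; split=> //; rewrite -invf_div; exact: res_unitV.
  - by rewrite sum0 mul0r => /res_unit_neq0; rewrite eqxx.
move: ir lr; rewrite !mem_filter => /andP[pi]; rewrite mem_index_iota => id.
move=> /andP[pl0 _].
have [|k [a ka a0]] := place_val pl (x := p`_i / p`_l).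
  by rewrite mulf_neq0 ?invr_eq0.
have uk : unit (j (p`_i / p`_l / s ^ k)) by exists a => //; exact: jres.
have js0 : j s != 0 by rewrite fmorph_eq0; exact: unif_neq0 pl.
have jp0 : j p`_i != 0 by rewrite fmorph_eq0.
have jl0 : j p`_l != 0 by rewrite fmorph_eq0.
have ux : unit (x ^+ (i - l) * j s ^ k).
  have := res_unitM ufil (res_unitV uk).
  have xi : x ^+ i = x ^+ (i - l) * x ^+ l by rewrite -exprD subnK // ltnW.
  rewrite /f xi !fmorph_div /= fmorphXz.
  congr unit; field.
  by rewrite jp0 jl0 expfz_neq0 // expf_neq0.
have : (i - l %| d`!)%N.
  by apply: dvdn_fact; rewrite subn_gt0 il (leq_trans (leq_subr _ _)) // -ltnS.
move=> /dvdnP[q ->]; exists (- (k * q%:Z)).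
rewrite mulnC exprM -invr_expz invrK.
have := res_unitX q ux.
by rewrite exprMn [(j s ^ k) ^+ q]exprnP exprz_exp.
Qed.

End Extend.

(** * Discrete places and their extension to finite extensions *)

(** The boundedness of the degrees is what keeps the extended valuation
discrete: x |-> d! v(x) takes its values in the value group of F, so its image
is an infinite cyclic group, and any x of least positive value is a
uniformizer. *)
Theorem place_extend (C : closedFieldType) (F E : fieldType)
    (iota : {rmorphism C -> F}) (j : {rmorphism F -> E}) (s : F)
    (res : F -> C -> Prop) (d : nat) :
    place iota s res ->
    (forall x : E, exists p : {poly F},
      [/\ p != 0, (size p <= d.+1)%N & root (map_poly j p) x]) ->
  exists s' res', place (j \o iota) s' res' /\
    forall y a, res y a -> res' (j y) a.
Proof.
move=> pl alg; have pp := place_pp pl.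
have [|G [ppG maxG resG]] := @maximal_place_exists C E (j \o iota)
    (fun y a => exists2 x, y = j x & res x a).
  split.
  - by move=> c; exists (iota c) => //; exact: res_const pp c.
  - move=> _ _ a b [x -> xa] [y -> yb]; exists (x - y); rewrite ?rmorphB //.
    exact: (resB pp).
  - move=> _ _ a b [x -> xa] [y -> yb]; exists (x * y); rewrite ?rmorphM //.
    exact: (resM pp).
  - move=> [x /esym/eqP]; rewrite fmorph_eq0 => /eqP ->; exact: res01 pp.
have jG y a : res y a -> G (j y) a by move=> ya; apply: resG; exists y.
have s0 := unif_neq0 pl; have js0 : j s != 0 by rewrite fmorph_eq0.
have Gs : G (j s) 0 by apply: jG; exact: res_unif pl.
pose unit := res_unit G.
(* W x l says that x has value l / d! in units of the value of s. *)
pose W x (l : int) := unit (x ^+ d`! / j s ^ l).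
have Wex x : x != 0 -> exists l, W x l.
  move=> x0; have [p [p0 sp px]] := alg x.
  exact: (algebraic_val ppG maxG pl jG x0 p0 sp px).
have WM x y k l : W x k -> W y l -> W (x * y) (k + l).
  move=> wx wy; rewrite /W exprMn expfzDr // invfM mulrACA.
  exact: (res_unitM ppG).
have WV x k : W x k -> W x^-1 (- k).
  move=> wx; rewrite /W exprVn -invr_expz -invfM.
  exact: (res_unitV ppG maxG).
have WX x k (n : nat) : W x k -> W (x ^+ n) (k * n%:Z).
  move=> wx; rewrite /W -exprM mulnC exprM -exprz_exp -exprnP -expr_div_n.
  exact: (res_unitX ppG).
have WXz x k (n : int) : W x k -> W (x ^ n) (k * n).
  case: n => n wx; first exact: WX.
  by rewrite NegzE mulrN; apply/WV/WX.
have Ws : W (j s) d`!%:Z.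
  by rewrite /W -exprnP divff ?expf_neq0 //; exact: res_unit1 ppG.
have W0 x : W x 0 -> unit x.
  rewrite /W expr0z divr1; exact: (res_unit_root ppG maxG (fact_gt0 d)).
have Wpos x (k : nat) : (0 < k)%N -> W x k%:Z -> G x 0.
  move=> k0 [a wx a0].
  have js := resX ppG k Gs.
  have := resM ppG wx js; rewrite -exprnP divfK ?expf_neq0 //.
  rewrite expr0n gtn_eqF // mulr0 => xd.
  have x0 : x != 0.
    apply: contraTneq a0 => x0; move: wx.
    by rewrite x0 expr0n gtn_eqF ?fact_gt0 // mul0r => /(res0_eq0 ppG) ->;
      rewrite eqxx.
  have zn : ~ unit (x ^+ d`!) by exact: (nonunit_res0 ppG xd).
  have [ux|//|xV] := res_unit_trichotomy ppG maxG x0.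
    by case: zn; exact: (res_unitX ppG).
  have := resM ppG (resX ppG d`! xV) xd.
  by rewrite exprVn mulVf ?expf_neq0 //
    mulr0 => /(res_fun ppG (res1 ppG))/eqP; rewrite oner_eq0.
pose D n := `[< (0 < n)%N /\ exists2 x, x != 0 & W x n%:Z >].
have exD : exists n, D n.
  by exists d`!; apply/asboolP; split; [exact: fact_gt0|exists (j s)].
case: (ex_minnP exD) => c /asboolP[c0 [s' s'0 Ws']] cmin.
exists s', G; split=> //; split=> //.
  exact: Wpos Ws'.
move=> x x0; have [l Wl] := Wex _ x0.
pose q := (l %/ c%:Z)%Z; exists q; apply: W0.
have Wr : W (x / s' ^ q) (l %% c%:Z)%Z.
  have -> : (l %% c%:Z)%Z = l + - (c%:Z * q) by rewrite mulrC.
  exact: WM Wl (WV _ _ (WXz _ _ q Ws')).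
have cnz : c%:Z != 0 by lia.
have [r Er] : exists r : nat, (l %% c%:Z)%Z = r%:Z.
  by exists `|(l %% c%:Z)%Z|%N; rewrite gez0_abs // modz_ge0.
rewrite Er in Wr *; case: r => // r in Wr Er *.
have : (c <= r.+1)%N.
  apply: cmin; apply/asboolP; split => //; exists (x / s' ^ q) => //.
  by rewrite mulf_neq0 ?invr_eq0 ?expfz_neq0.
by have := ltz_mod l cnz; rewrite Er; lia.
Qed.

Lemma irreducible_factor (F : fieldType) (p : {poly F}) : (1 < size p)%N ->
  exists2 q, irreducible_poly q & q %| p.
Proof.
elim: {p}(size p) {-2}p (leqnn (size p)) => [|n IH] p.
  by rewrite leqn0 => /eqP ->.
move=> pn p1; have [irr|nirr] := pselect (irreducible_poly p);
  first by exists p.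
have [q [q1 qp qnp]] : exists q :
    {poly F}, [/\ size q != 1%N, q %| p & ~~ (q %= p)].
  apply: contrapT => no; apply: nirr; split => // q q1 qp.
  by apply: contrapT => nq; apply: no; exists q; split => //; exact/negP.
have p0 : p != 0 by rewrite -size_poly_gt0 ltnW.
have q0 : q != 0 by apply: dvdpN0 qp p0.
have sqp : (size q < size p)%N.
  by rewrite ltn_neqAle dvdp_leq // andbT dvdp_size_eqp.
have [||r irr rq] := IH q.
- by rewrite -ltnS (leq_trans sqp).
- by rewrite ltn_neqAle eq_sym q1 size_poly_gt0.
by exists r => //; exact: dvdp_trans rq qp.
Qed.

Lemma root_extension (C : closedFieldType) (F : fieldType)
    (iota : {rmorphism C -> F}) (s : F) (res : F -> C -> Prop) (p : {poly F}) :
    place iota s res -> (1 < size p)%N ->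
  exists (E : fieldType) (j : {rmorphism F -> E}) s' res',
    [/\ place (j \o iota) s' res', forall y a, res y a -> res' (j y) a &
      exists z, root (map_poly j p) z].
Proof.
move=> pl p1; have [q irr qp] := irreducible_factor p1.
have [L dimL [z qz _]] := irredp_FAdjoin irr.
have [|s' [res' [pl' ext]]] :=
    @place_extend C F L iota (in_alg L) s res (\dim {:L}) pl.
  move=> x; have /polyOver1P[r Er] := minPolyOver 1%AS x.
  exists r; rewrite -Er root_minPoly; split => //.
    by rewrite -(map_poly_eq0 (in_alg L)) -Er monic_neq0 // monic_minPoly.
  rewrite -(size_map_poly (in_alg L)) -Er size_minPoly ltnS adjoin_degreeE.
  by rewrite dimv1 divn1 dimvS // subvf.
exists L, (in_alg L), s', res'; split => //; exists z.
rewrite -!dvdp_XsubCl in qz *; apply: dvdp_trans qz _.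
by rewrite dvdp_map.
Qed.

(** Adjoining a root z of p(X^2) produces the root z^2 of p, which is a
square by construction; the remaining factor has smaller degree. *)
Theorem square_splitting (C : closedFieldType) (F : fieldType)
    (iota : {rmorphism C -> F}) (s : F) (res : F -> C -> Prop) (p : {poly F}) :
    place iota s res -> p \is monic ->
  exists (E : fieldType) (j : {rmorphism F -> E}) s' res' (r : seq E),
    [/\ place (j \o iota) s' res', forall y a, res y a -> res' (j y) a &
      map_poly j p = \prod_(b <- r) ('X - (b ^+ 2)%:P)].
Proof.
move: {2}(size p) (leqnn (size p)) => n.
elim: n => [|n IH] in F iota s res p *.
  rewrite leqn0 size_poly_eq0 => /eqP -> _.
  by rewrite monicE lead_coef0 eq_sym oner_eq0.
move=> sp pl pm.
have [p1|p1] := leqP (size p) 1.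
  exists F, idfun, s, res, [::]; split => //.
  have p0 := monicP pm; rewrite lead_coefE in p0.
  rewrite big_nil map_poly_id // (size1_polyC p1).
  suff -> : p`_0 = 1 by [].
  by move: p1 p0; case: (size p) => [|[|]].
have [|E1 [j1 [s1 [res1 [pl1 ext1 [z]]]]]] :=
    root_extension (p := p \Po 'X^2) pl.
  have := size_comp_poly p 'X^2; rewrite size_polyXn /=.
  by move: p1; case: (size p) => [|[|k]] //=; case: (size _) => [|[|]].
rewrite map_comp_poly map_polyXn rootE horner_comp hornerXn -rootE.
move=> /factor_theorem[q Eq].
have qm : q \is monic by rewrite -(monicMr _ (monicXsubC (z ^+ 2))) -Eq
  map_monic.
have [|E [j2 [s2 [res2 [r [pl2 ext2 Er]]]]]] :=
    IH E1 (j1 \o iota) s1 res1 q _ pl1 qm.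
  have := congr1 (fun p : {poly E1} => size p) Eq; rewrite size_map_poly.
  rewrite size_Mmonic ?monicXsubC ?monic_neq0 // size_XsubC addn2 /= => Ep.
  by rewrite -ltnS -Ep.
exists E, (j2 \o j1), s2, res2, (j2 z :: r); split => //.
  by move=> y a /ext1/ext2.
rewrite map_poly_comp Eq rmorphM /= Er big_cons mulrC; congr (_ * _).
by rewrite rmorphB /= map_polyX map_polyC /= rmorphXn.
Qed.

(** * Square roots of matrices *)

(** The square root q of X is built one factor at a time, looking for the
next one in the form q + c f with a constant c.  The value of c is a root of a
polynomial of degree at most 2 and discriminant 4 b^2.  This is a nonzero
square, so a root exists even when the degree drops to 1, that is, when b^2 is
a repeated root. *)
Lemma sqrtX_mod_prod (F : fieldType) (r : seq F) :
    (2%:R : F) != 0 -> all (fun b => b != 0) r ->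
  exists q, \prod_(b <- r) ('X - (b ^+ 2)%:P) %| q ^+ 2 - 'X.
Proof.
move=> two0; elim: r => [|b r IH] /=; first by exists 0; rewrite big_nil dvd1p.
move=> /andP[b0 /IH[q /dvdpP[h Eh]]]; rewrite big_cons.
set f := \prod_(_ <- r) _ in Eh *; set a := b ^+ 2.
have Ea : q.[a] ^+ 2 - a = h.[a] * f.[a].
  by have := congr1 (fun p => p.[a]) Eh; rewrite !hornerE.
(* The condition on c for q + c f to have the square a at a, divided by f. *)
have [c Ec] : exists c, h.[a] + 2 * c * q.[a] + c ^+ 2 * f.[a] = 0.
  have [f0|f0] := eqVneq f.[a] 0.
    have q0 : q.[a] != 0.
      apply: contra_neq b0 => q0; move: Ea; rewrite f0 q0 mulr0 expr0n sub0r.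
      by move/eqP; rewrite oppr_eq0 expf_eq0 => /andP[_ /eqP].
    by exists (- h.[a] / (2 * q.[a])); rewrite f0; field; rewrite q0.
  exists ((b - q.[a]) / f.[a]); apply: (mulfI f0); rewrite mulr0.
  transitivity (h.[a] * f.[a] - (q.[a] ^+ 2 - a)); last by rewrite Ea subrr.
  by rewrite /a; field.
exists (q + c *: f).
have -> : (q + c *: f) ^+ 2 - 'X = f * (h + (2 * c) *: q + c ^+ 2 *: f).
  rewrite -!mul_polyC polyCM (_ : 2%:P = 2) ?rmorphXn /=;
    last by rewrite -polyC_natr.
  transitivity (q ^+ 2 - 'X + f * (2 * c%:P * q + c%:P ^+ 2 * f));
    first by ring.
  by rewrite Eh; ring.
rewrite mulrC dvdp_mul // dvdp_XsubCl rootE !hornerE.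
by apply/eqP.
Qed.

(** That S is a polynomial in M is expressed by an induction principle, which
is the form in which it is used and also makes sense for matrices of size 0. *)
Lemma mx_sqrt (F : fieldType) (n : nat) (M : 'M[F]_n) (r : seq F) :
    (2%:R : F) != 0 -> all (fun b => b != 0) r ->
    char_poly M = \prod_(b <- r) ('X - (b ^+ 2)%:P) ->
  exists S, S *m S = M /\ forall D : 'M[F]_n -> Prop,
    D 0 -> D 1%:M -> (forall A B, D A -> D B -> D (A + B)) ->
    (forall c A, D A -> D (c *: A)) -> (forall A, D A -> D (A *m M)) -> D S.
Proof.
move=> two0 r0 charM; case: n => [|n] in M charM *.
  by exists 0; split => //; rewrite [RHS]flatmx0 [LHS]flatmx0.
have [q /dvdpP[h Eq]] := sqrtX_mod_prod two0 r0.
exists (horner_mx M q); split.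
  have := congr1 (horner_mx M) Eq.
  rewrite rmorphB rmorphXn /= horner_mx_X rmorphM -charM /= Cayley_Hamilton
    mulr0.
  by move/eqP; rewrite subr_eq0 => /eqP.
move=> D D0 D1 DD DZ DM; elim/poly_ind: q {h Eq} => [|q c IH].
  by rewrite rmorph0.
rewrite rmorphD rmorphM /= horner_mx_X horner_mx_C.
by apply: DD; [exact: DM|rewrite -scalemx1; exact: DZ].
Qed.

(** * Evaluating rational functions at a uniformizer *)

Lemma res_horner (C E : fieldType) (iota : {rmorphism C -> E}) res x a p :
  partial_place iota res -> res x a -> res (map_poly iota p).[x] p.[a].
Proof.
move=> pp xa; rewrite (horner_coef_wide (n := size p)) ?size_map_poly //.
rewrite horner_coef; apply: (res_sum pp) => i _; rewrite coef_map.
by apply: (resM pp); [exact: res_const pp _|exact: (resX pp)].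
Qed.

Section FractionLift.
Variables (R : idomainType) (E : fieldType) (f : {rmorphism R -> E}).
Hypothesis f_inj : injective f.

Lemma fraction_reprE (r : {ratio R}) :
  (\pi_({fraction R}) r)%qT =
    FracField.tofrac (frac r).1 / FracField.tofrac (frac r).2.
Proof.
have d0 := denom_ratioP r.
have td0 : FracField.tofrac (frac r).2 != 0 by rewrite tofrac_eq0.
apply: (mulIf td0); rewrite divfK //.
rewrite /FracField.tofrac; unlock FracField.tofrac.
rewrite -[LHS]FracField.pi_mul; apply/eqmodP.
rewrite /= FracField.equivfE /FracField.mulf !numden_Ratio ?oner_eq0 ?mulr1
  ?mul1r ?mulf_neq0 //.
by rewrite mulrC.
Qed.

Lemma fraction_ex (x : {fraction R}) :
  exists n d, d != 0 /\ x = FracField.tofrac n / FracField.tofrac d.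
Proof.
exists (frac (repr x)).1, (frac (repr x)).2.
by rewrite -fraction_reprE reprK denom_ratioP.
Qed.

Definition fraction_lift (x : {fraction R}) : E :=
  f (frac (repr x)).1 / f (frac (repr x)).2.

Lemma fraction_liftE n d : d != 0 ->
  fraction_lift (FracField.tofrac n / FracField.tofrac d) = f n / f d.
Proof.
move=> d0; set x := FracField.tofrac n / _; rewrite /fraction_lift.
have fd0 : f d != 0 by rewrite -(rmorph0 f) (inj_eq f_inj).
have := denom_ratioP (repr x); set n' := (frac (repr x)).1;
  set d' := (frac _).2 => d'0.
have fd'0 : f d' != 0 by rewrite -(rmorph0 f) (inj_eq f_inj).
have td0 : FracField.tofrac d != 0 by rewrite tofrac_eq0.
have td'0 : FracField.tofrac d' != 0 by rewrite tofrac_eq0.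
have : n * d' = n' * d.
  apply/eqP; rewrite -tofrac_eq !rmorphM /= -(eqr_div _ _ td0 td'0) -/x.
  by rewrite -{1}[x]reprK fraction_reprE.
by move=> /(congr1 f); rewrite !rmorphM /= => H; apply/eqP; rewrite eqr_div ?H.
Qed.

(** The universal property of the field of fractions. *)
Lemma fraction_lift_morphism :
  exists sigma : {rmorphism {fraction R} -> E},
    forall p, sigma (FracField.tofrac p) = f p.
Proof.
have liftP n d := @fraction_liftE n d.
have lift_tofrac p : fraction_lift (FracField.tofrac p) = f p.
  by have := liftP p 1 (oner_neq0 _); rewrite !rmorph1 !divr1.
have f0 (x : R) : x != 0 -> f x != 0 by rewrite -(rmorph0 f) (inj_eq f_inj).
have liftB : zmod_morphism fraction_lift.
  move=> x y; have [n [d [d0 ->]]] := fraction_ex x.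
  have [n' [d' [d'0 ->]]] := fraction_ex y.
  have t0 := d0; have t'0 := d'0; rewrite -tofrac_eq0 in t0;
    rewrite -tofrac_eq0 in t'0.
  rewrite -mulNr addf_div // -!rmorphM -rmorphN -rmorphM -rmorphD.
  rewrite !liftP ?mulf_neq0 // rmorphD !rmorphM rmorphN -mulNr addf_div ?f0 //.
have liftM : monoid_morphism fraction_lift.
  split; first by rewrite -(rmorph1 (@FracField.tofrac R)) lift_tofrac rmorph1.
  move=> x y; have [n [d [d0 ->]]] := fraction_ex x.
  have [n' [d' [d'0 ->]]] := fraction_ex y.
  by rewrite mulf_div -!rmorphM !liftP ?mulf_neq0 // !rmorphM mulf_div.
pose H1 := GRing.isZmodMorphism.Build _ _ fraction_lift liftB.
pose H2 := GRing.isMonoidMorphism.Build _ _ fraction_lift liftM.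
pose sigma : {rmorphism {fraction R} -> E} := HB.pack fraction_lift H1 H2.
by exists sigma.
Qed.

End FractionLift.

(** * Laurent matrices and residues of matrices *)

Lemma invmx_mul (F : fieldType) n (A B : 'M[F]_n) : A \in unitmx ->
    B \in unitmx ->
  invmx (A *m B) = invmx B *m invmx A.
Proof.
move=> uA uB; have uAB : A *m B \in unitmx by rewrite unitmx_mul uA.
apply: (can_inj (mulKmx uAB)); rewrite mulmxV // mulmxA -(mulmxA A) mulmxV //.
by rewrite mulmx1 mulmxV.
Qed.

Lemma invmx_right (F : fieldType) n (A B : 'M[F]_n) : A *m B = 1%:M ->
    invmx A = B.
Proof.
by move=> AB; have [uA _] := mulmx1_unit AB;
  rewrite -[invmx A]mulmx1 -AB mulKmx.
Qed.

Section LaurentRing.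
Variable C : numFieldType.
Local Notation ratfun := {fraction {poly C}}.

Lemma ratX_neq0 k : ratfun_poly ('X^k : {poly C}) != 0.
Proof. by rewrite tofrac_eq0 -size_poly_gt0 size_polyXn. Qed.

Lemma laurent_poly (p : {poly C}) : laurent (ratfun_poly p).
Proof. by exists p, 0%N; rewrite expr0 /ratfun_poly rmorph1 divr1. Qed.

Lemma laurentM (f g : ratfun) : laurent f -> laurent g -> laurent (f * g).
Proof.
move=> [p [k ->]] [q [l ->]]; exists (p * q), (k + l)%N.
by rewrite exprD /ratfun_poly !rmorphM mulf_div.
Qed.

Lemma laurentD (f g : ratfun) : laurent f -> laurent g -> laurent (f + g).
Proof.
move=> [p [k ->]] [q [l ->]]; exists (p * 'X^l + q * 'X^k), (k + l)%N.
by rewrite exprD /ratfun_poly rmorphD !rmorphM addf_div // ratX_neq0.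
Qed.

Lemma laurent_sum (I : Type) (r : seq I) (P : pred I) (F : I -> ratfun) :
  (forall i, P i -> laurent (F i)) -> laurent (\sum_(i <- r | P i) F i).
Proof.
move=> FL; apply: big_ind => //; last exact: laurentD.
by rewrite -(rmorph0 (@FracField.tofrac {poly C})); exact: laurent_poly.
Qed.

Lemma laurent_mulmx n m p (A : 'M[ratfun]_(n, m)) (B : 'M[ratfun]_(m, p)) :
  (forall i j, laurent (A i j)) -> (forall i j, laurent (B i j)) ->
  forall i j, laurent ((A *m B) i j).
Proof. by move=> LA LB i j; rewrite mxE; apply: laurent_sum => k _;
  exact: laurentM. Qed.

Lemma laurent_GLM n (A B : 'M[ratfun]_n) :
  laurent_GL A -> laurent_GL B -> laurent_GL (A *m B).
Proof.
move=> [uA LA LA'] [uB LB LB'];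
  have uAB : A *m B \in unitmx by rewrite unitmx_mul uA.
split; [exact: uAB|exact: laurent_mulmx LA LB|].
suff -> : invmx (A *m B) = invmx B *m invmx A by exact: laurent_mulmx LB' LA'.
exact (invmx_mul uA uB).
Qed.

Lemma laurent_GL_intro n (A B : 'M[ratfun]_n) : A *m B = 1%:M ->
  (forall i j, laurent (A i j)) -> (forall i j, laurent (B i j)) -> laurent_GL
    A.
Proof.
move=> AB LA LB; have [uA _] := mulmx1_unit AB; split; [exact: uA|exact: LA|].
by rewrite (invmx_right AB).
Qed.

Lemma laurent_GL_const n (A : 'M[C]_n) : A \in unitmx ->
  laurent_GL (map_mx (@ratfun_const C) A).
Proof.
move=> uA; apply: (laurent_GL_intro (B := map_mx (@ratfun_const C) (invmx A))).
- rewrite -[@ratfun_const C]/(@FracField.tofrac {poly C} \o polyC).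
  by rewrite -map_mxM mulmxV // map_mx1.
- by move=> i j; rewrite mxE; exact: laurent_poly.
- by move=> i j; rewrite mxE; exact: laurent_poly.
Qed.

Definition dilation_mx (F : fieldType) n (j0 : 'I_n) (x : F) : 'M[F]_n :=
  diag_mx (\row_j (if j == j0 then x else 1)).

Lemma dilation_mxV (F : fieldType) n (j0 : 'I_n) (x : F) : x != 0 ->
  dilation_mx j0 x *m dilation_mx j0 x^-1 = 1%:M.
Proof.
move=> x0; rewrite mulmx_diag -diag_const_mx; congr diag_mx.
by apply/rowP => j; rewrite !mxE; case: eqP => _; rewrite ?divff ?mulr1.
Qed.

Lemma map_dilation_mx (F E : fieldType) (f : {rmorphism F -> E}) n
    (j0 : 'I_n) x :
  map_mx f (dilation_mx j0 x) = dilation_mx j0 (f x).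
Proof.
rewrite map_diag_mx; congr diag_mx; apply/rowP => j; rewrite !mxE.
by case: eqP => _ //; rewrite rmorph1.
Qed.

Lemma laurent_GL_dilation n (j0 : 'I_n) :
  laurent_GL (dilation_mx j0 (ratfun_poly ('X : {poly C}))).
Proof.
have L b : laurent (b%:R : ratfun).
  by have := laurent_poly b%:R; rewrite /ratfun_poly rmorph_nat.
have X0 : ratfun_poly ('X : {poly C}) != 0 by have := ratX_neq0 1.
have LX : laurent (ratfun_poly ('X : {poly C}))^-1.
  by exists 1, 1%N; rewrite /ratfun_poly rmorph1 div1r expr1.
apply: (laurent_GL_intro (dilation_mxV j0 X0)) => i j; rewrite !mxE.
  case: (i == j); rewrite ?mulr0n ?mulr1n; last exact: (L 0%N).
  by case: ifP => _; [exact: laurent_poly|exact: (L 1%N)].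
case: (i == j); rewrite ?mulr0n ?mulr1n; last exact: (L 0%N).
by case: ifP => _; [exact: LX|exact: (L 1%N)].
Qed.

End LaurentRing.

Section LaurentLimit.
Variable C : numFieldType.
Local Open Scope classical_set_scope.

Lemma horner_cvg (p : {poly C}) : p.[t] @[t --> (0 : C)^'] --> p.[0].
Proof.
suff H : p.[t] @[t --> (0 : C)] --> p.[0] by apply/continuous_withinNx;
  exact: H.
elim/poly_ind: p => [|p c IH].
  rewrite (_ : horner 0 = fun=> 0); last by apply/funext => t; rewrite horner0.
  exact: (@cvg_cst C 0 C (nbhs (0 : C)) _).
rewrite (_ : horner _ = fun t => p.[t] * t + c); last first.
  by apply/funext => t; rewrite hornerMXaddC.
exact: (cvgD (cvgM IH (@cvg_id _ _)) (@cvg_cst C c C (nbhs (0 : C)) _)).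
Qed.

Lemma laurent_cvg0_poly (p : {poly C}) : laurent_cvg0 (ratfun_poly p) p.[0].
Proof.
exists p, 0%N; split.
  by rewrite expr0 /ratfun_poly rmorph1 divr1.
under eq_fun do rewrite expr0 divr1.
exact: horner_cvg.
Qed.

(** The analytic limit of a polynomial is its value at 0, so that all limits
reduce to algebra. *)
Lemma laurent_cvg0_polyE (p : {poly C}) l :
  laurent_cvg0 (ratfun_poly p) l -> l = p.[0].
Proof.
move=> [q [k [Epq ql]]].
have Eq : q = p * 'X^k.
  apply/eqP; rewrite -tofrac_eq rmorphM; apply/eqP.
  by have X0 := ratX_neq0 C k;
    have := congr1 (fun x => x * ratfun_poly 'X^k) Epq; rewrite divfK.
apply: (cvg_unique _ ql); first exact: norm_hausdorff.
apply: (cvg_trans _ (horner_cvg (p := p))); apply: near_eq_cvg.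
near=> t; have t0 : t != 0 by near: t; exact: nbhs_dnbhs_neq.
by rewrite Eq hornerM hornerXn mulfK // expf_neq0.
Unshelve. all: by end_near.
Qed.

End LaurentLimit.

Section ResMatrix.
Variables (C E : fieldType) (iota : {rmorphism C -> E}) (res : E -> C -> Prop).
Hypothesis pp : partial_place iota res.

Definition res_mx n m (A : 'M[E]_(n, m)) (B : 'M[C]_(n, m)) :=
  forall i j, res (A i j) (B i j).

Lemma res_mulmx n m p (A : 'M[E]_(n, m)) A' (B : 'M[E]_(m, p)) B' :
  res_mx A A' -> res_mx B B' -> res_mx (A *m B) (A' *m B').
Proof. by move=> rA rB i j; rewrite !mxE; apply: (res_sum pp) => k _;
  exact: (resM pp). Qed.

Lemma res_mx_const n m (A : 'M[C]_(n, m)) : res_mx (map_mx iota A) A.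
Proof. by move=> i j; rewrite mxE; exact: (res_const pp). Qed.

Lemma res_det n (A : 'M[E]_n) A' : res_mx A A' -> res (\det A) (\det A').
Proof.
move=> rA; rewrite /determinant; apply: (res_sum pp) => s _.
apply: (resM pp); last by apply: (res_prod pp) => i _.
by apply: (resX pp); apply: (resN pp); exact: (res1 pp).
Qed.

Lemma res_mx_exists n m (A : 'M[E]_(n, m)) :
  (forall i j, exists a, res (A i j) a) -> exists A', res_mx A A'.
Proof.
move=> H; exists (\matrix_(i, j) projT1 (cid (H i j))) => i j.
by rewrite mxE; case: cid.
Qed.

End ResMatrix.

Section Place.
Variables (C E : fieldType) (iota : {rmorphism C -> E}) (s : E) (res : E -> C
  -> Prop).
Hypothesis pl : place iota s res.
Let pp := place_pp pl.

(** The valuation of x and of its inverse add up to 0, and any nonzero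
valuation would force the residue of x or of a unit to vanish. *)
Lemma place_inv x a : res x a -> a != 0 -> res x^-1 a^-1.
Proof.
move=> xa a0; have x0 := res_neq0 pp xa a0.
have s0 := unif_neq0 pl.
have [k [b yb b0]] : exists k : int, res_unit res (x^-1 / s ^ k).
  by apply: (place_val pl); rewrite invr_eq0.
have : res (s ^ (- k)) (a * b).
  have := resM pp xa yb; rewrite mulrA divff // mul1r -invr_expz //.
have spos (n : nat) c : (0 < n)%N -> c != 0 -> ~ res (s ^ n%:Z) c.
  move=> n0 c0 sc; have := res_fun pp (resX pp n (res_unif pl)) sc.
  by move/eqP; rewrite expr0n gtn_eqF // eq_sym (negPf c0).
have ab0 : a * b != 0 by rewrite mulf_neq0.
case: k yb => [[|n]|n] yb.
- rewrite expr0z divr1 in yb; rewrite oppr0 expr0z => ab1.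
  suff -> : a^-1 = b by [].
  by apply: (mulfI a0); rewrite divff // (res_fun pp ab1 (res1 pp)).
- move=> sab; have := resM pp (resX pp n.+1 (res_unif pl)) sab.
  rewrite exprnP -expfzDr // subrr expr0z expr0n mul0r.
  by move=> /(res_fun pp (res1 pp))/eqP; rewrite oner_eq0.
- by rewrite NegzE opprK => /spos; case.
Qed.

Lemma place_div_unif x : res x 0 -> exists a, res (x / s) a.
Proof.
move=> x0; have s0 := unif_neq0 pl.
have [->|xn0] := eqVneq x 0; first by exists 0; rewrite mul0r; exact: res0 pp.
have [k [b yb b0]] := place_val pl xn0.
case: k yb => [[|n]|n] yb.
- rewrite expr0z divr1 in yb; have := res_fun pp yb x0.
  by move/eqP; rewrite (negPf b0).
- have := resM pp yb (resX pp n (res_unif pl)).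
  rewrite -exprnP exprS invfM mulrA divfK ?expf_neq0 // => H; by eexists;
    exact: H.
- have := resM pp x0 (resX pp n.+1 (res_unif pl)).
  move: yb; rewrite NegzE -invr_expz invrK -exprnP mul0r => yb /(res_fun pp
    yb)/eqP.
  by rewrite (negPf b0).
Qed.

Lemma place_pow_dom x : exists N : nat, exists a, res (x * s ^+ N) a.
Proof.
have s0 := unif_neq0 pl.
have [->|xn0] := eqVneq x 0; first by exists 0%N, 0; rewrite mul0r;
  exact: res0 pp.
have [k [b yb b0]] := place_val pl xn0.
case: k yb => [n|n] yb.
  exists 0%N; exists (b * 0 ^+ n);
    rewrite expr0 mulr1 -[x](divfK (expf_neq0 n s0)).
  by apply: (resM pp) => //; exact: (resX pp n (res_unif pl)).
by exists n.+1, b; move: yb; rewrite NegzE -invr_expz invrK.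
Qed.

Lemma res_invmx n (A : 'M[E]_n) B : res_mx res A B -> B \in unitmx ->
  A \in unitmx /\ res_mx res (invmx A) (invmx B).
Proof.
move=> rA uB; have rd := res_det pp rA.
have dB : \det B != 0 by move: uB; rewrite unitmxE unitfE.
have uA : A \in unitmx by rewrite unitmxE unitfE (res_neq0 pp rd).
split=> // i j; rewrite /invmx uA uB !mxE; apply: (resM pp).
  exact: place_inv.
rewrite /cofactor; apply: (resM pp).
  by apply: (resX pp); apply: (resN pp); exact: (res1 pp).
by apply: (res_det pp) => k l; rewrite !mxE.
Qed.

End Place.

(** * Decomposition of matrices over a discretely valued field *)

Section Decomposition.
Variables (C : numFieldType) (E : fieldType) (iota : {rmorphism C -> E}).
Variables (s : E) (res : E -> C -> Prop).
Hypothesis pl : place iota s res.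
Let pp := place_pp pl.
Local Notation ratfun := {fraction {poly C}}.
Variable sigma : {rmorphism ratfun -> E}.
Hypothesis sigma_poly : forall p, sigma (ratfun_poly p) = (map_poly iota p).[s].

Lemma sigma_const c : sigma (ratfun_const c) = iota c.
Proof. by rewrite sigma_poly map_polyC hornerC. Qed.

Lemma sigma_X : sigma (ratfun_poly 'X) = s.
Proof. by rewrite sigma_poly map_polyX hornerX. Qed.

Lemma sigma_map_const n m (A : 'M[C]_(n, m)) :
  map_mx sigma (map_mx (@ratfun_const C) A) = map_mx iota A.
Proof. by apply/matrixP => i j; rewrite !mxE sigma_const. Qed.

(** Induction on the valuation v of the determinant.  If the reduction N of h
is invertible, then h N^-1 reduces to the identity.  Otherwise a constant change
of columns makes the last column of h divisible by s; dividing it by s gives an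
integral matrix with a determinant of valuation v - 1, and the operations made
on the columns are invertible Laurent matrices. *)
Lemma integral_decomposition m (v : nat) (h : 'M[E]_m) (N : 'M[C]_m) :
    res_mx res h N -> res_unit res (\det h / s ^+ v) ->
  exists g k, [/\ laurent_GL g, h = k *m map_mx sigma g & res_mx res k 1%:M].
Proof.
have s0 := unif_neq0 pl.
elim: v h N => [|v IH] h N hN hv.
all: have [uN|nuN] := boolP (N \in unitmx).
1,3: exists (map_mx (@ratfun_const C) N), (h *m map_mx iota (invmx N)).
1,2: split; [exact: laurent_GL_const| |].
1,3: by rewrite sigma_map_const -mulmxA -map_mxM mulVmx // map_mx1 mulmx1.
1,2: by rewrite -(mulmxV uN); apply: (res_mulmx pp) => //;
  exact: (res_mx_const pp).
  move: hv nuN; rewrite expr0 divr1 unitmxE unitfE negbK => -[a ha a0].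
  by rewrite (res_fun pp (res_det pp hN) ha) (negPf a0).
case: m h N hN hv nuN IH => [|m] h N hN hv nuN IH.
  by rewrite unitmxE det_mx00 unitr1 in nuN.
have rN : (\rank N < m.+1)%N.
  by rewrite ltn_neqAle rank_leq_row andbT -row_full_unit in nuN *.
(* The last column of N *m c vanishes because N is singular of size m + 1. *)
pose c := invmx (row_ebase N).
have uc : c \in unitmx by rewrite unitmx_inv row_ebase_unit.
have Nc i : (N *m c) i ord_max = 0.
  have -> : N *m c = col_ebase N *m pid_mx (\rank N).
    apply: (can_inj (mulmxK (row_ebase_unit N))).
    by rewrite mulmx_ebase /c mulmxKV ?row_ebase_unit.
  rewrite mxE.
  rewrite big1 // => k _; rewrite mxE /= ; case: eqP => [->|];
    rewrite ?mulr0 //.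
  by rewrite ltnNge -ltnS rN mulr0.
pose h1 := h *m map_mx iota c *m dilation_mx ord_max s^-1.
have hc : res_mx res (h *m map_mx iota c) (N *m c).
  by apply: (res_mulmx pp) => //; exact: (res_mx_const pp).
have [i j|N1 hN1] := @res_mx_exists C E res _ _ h1.
  have -> : h1 i j =
      (h *m map_mx iota c) i j * (if j == ord_max then s^-1 else 1).
    by rewrite /h1 mul_mx_diag mxE [X in _ * X]mxE.
  case: eqP => [->|_].
    by apply: (place_div_unif pl); rewrite -(Nc i); exact: hc.
  by rewrite mulr1; eexists; exact: hc.
have [|g1 [k [Lg1 h1E k1]]] := IH h1 N1 hN1.
  have -> : \det h1 / s ^+ v = \det h / s ^+ v.+1 * iota (\det c).
    rewrite !det_mulmx det_map_mx det_diag (bigD1 ord_max) //= big1 ?mxE ?eqxx.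
      by rewrite mulr1 exprS; field; rewrite s0 expf_neq0.
    by move=> i /negPf ni; rewrite mxE ni.
  case: hv => a ha a0; exists (a * \det c).
    by apply: (resM pp) => //; exact: (res_const pp).
  by rewrite mulf_neq0 // -unitfE -unitmxE.
exists (g1 *m dilation_mx ord_max (ratfun_poly 'X) *m map_mx (@ratfun_const C)
  (invmx c)), k.
have uc' : invmx c \in unitmx by rewrite unitmx_inv.
split; last exact k1.
  exact (laurent_GLM (laurent_GLM Lg1 (laurent_GL_dilation C ord_max))
           (laurent_GL_const uc')).
rewrite !map_mxM map_dilation_mx /= sigma_X sigma_map_const !mulmxA -h1E.
rewrite /h1 -!mulmxA [dilation_mx _ _ *m (_ *m _)]mulmxA.
rewrite -{2}[s]invrK dilation_mxV ?invr_eq0 // mul1mx.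
by rewrite -map_mxM mulmxV // map_mx1 mulmx1.
Qed.

(** Multiplication by a power of s, which is an invertible Laurent matrix,
reduces to the integral case. *)
Lemma laurent_decomposition m (h : 'M[E]_m) : h \in unitmx ->
  exists g k, [/\ laurent_GL g, h = k *m map_mx sigma g & res_mx res k 1%:M].
Proof.
move=> uh; have s0 := unif_neq0 pl.
have [N HN] : exists N : nat, forall i j, exists a, res ((s ^+ N *: h) i j) a.
  pose f i j := projT1 (cid (place_pow_dom pl (h i j))).
  exists (\max_i \max_j f i j)%N => i j; rewrite !mxE.
  have fN : (f i j <= \max_i \max_j f i j)%N.
    by apply: (leq_trans (leq_bigmax j)); exact: (leq_bigmax i).
  rewrite /f in fN; case: cid fN => M [a ha] /= fN.
  rewrite -(subnKC fN) exprD mulrC mulrA; eexists.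
  by apply: (resM pp); [exact: ha|exact: (resX pp _ (res_unif pl))].
have [h' hh'] := res_mx_exists HN.
have dh : \det (s ^+ N *: h) != 0.
  by rewrite detZ mulf_neq0 ?expf_neq0 // -unitfE -unitmxE.
have [k hk] := place_val pl dh.
have [v Ev] : exists v : nat, k = v.
  case: k hk => [v|v]; first by exists v.
  rewrite NegzE -invr_expz invrK -exprnP => -[a ha a0].
  have := resM pp (res_det pp hh') (resX pp v.+1 (res_unif pl)).
  by rewrite expr0n mulr0 => /(res_fun pp ha)/eqP; rewrite (negPf a0).
rewrite Ev in hk; have [g [k' [Lg Eh k1]]] := integral_decomposition hh' hk.
have X0 : ratfun_poly ('X : {poly C}) != 0 by have := ratX_neq0 C 1.
pose xN : ratfun := (ratfun_poly 'X) ^+ N.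
have xN0 : xN != 0 by rewrite expf_neq0.
have xNV : xN^-1%:M *m xN%:M =
    1%:M :> 'M[ratfun]_m by rewrite -scalar_mxM mulVf.
have L0 : laurent (0 : ratfun).
  by have := laurent_poly (0 : {poly C}); rewrite /ratfun_poly rmorph0.
exists (g *m xN^-1%:M), k'; split; last exact k1.
  apply: (laurent_GLM Lg); apply: (laurent_GL_intro xNV) => i j; rewrite mxE.
    case: (i == j); last exact: L0.
    by exists 1, N; rewrite mulr1n /xN /ratfun_poly rmorph1 rmorphXn div1r.
  case: (i == j); last exact: L0.
  by rewrite mulr1n /xN -rmorphXn; exact: laurent_poly.
rewrite map_mxM map_scalar_mx mulmxA -Eh mul_mx_scalar fmorphV rmorphXn sigma_X.
by rewrite scalerA mulVf ?expf_neq0 // scale1r.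
Qed.

(** A Laurent polynomial in s that is integral has no pole: if its
denominator is divisible by X then its numerator takes at s a value of residue
0, hence is divisible by X as well. *)
Lemma laurent_cvg0_of_res (f : ratfun) (c : C) :
  laurent f -> res (sigma f) c -> laurent_cvg0 f c.
Proof.
move=> [p [k ->]].
have s0 := unif_neq0 pl.
have X0 := ratX_neq0 C.
have reg (r : {poly C}) :
    res (sigma (ratfun_poly r)) c -> laurent_cvg0 (ratfun_poly r) c.
  have s00 : res s 0 := res_unif pl.
  move=> rc; have -> : c = r.[0].
    by apply: (res_fun pp rc); rewrite sigma_poly; exact: (res_horner r pp s00).
  exact: laurent_cvg0_poly.
elim: k p => [|k IH] p.
  rewrite expr0 {2}/ratfun_poly rmorph1 divr1; exact: reg.
move=> rc.
have s00 : res s 0 := res_unif pl.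
have rp0 : res (sigma (ratfun_poly p)) 0.
  have := resM pp rc (resX pp k.+1 s00).
  rewrite expr0n mulr0 fmorph_div [X in _ / X]sigma_poly map_polyXn hornerXn.
  by rewrite divfK // expf_neq0.
have : root p 0.
  rewrite rootE; apply/eqP; apply: (res_fun pp _ rp0).
  by rewrite sigma_poly; exact: (res_horner p pp s00).
move=> /factor_theorem[q Eq].
have E1 : ratfun_poly p / ratfun_poly ('X^(k.+1) : {poly C}) =
    ratfun_poly q / ratfun_poly ('X^k : {poly C}).
  rewrite Eq subr0 exprSr /ratfun_poly !rmorphM -mulf_div divff ?mulr1 //.
  exact: (X0 1%N).
by rewrite E1 in rc *; exact: IH.
Qed.

End Decomposition.

(** * Isotopes of Jordan algebras of matrices *)

Section Families.
Variables (F : fieldType) (n m : nat).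
Implicit Types (x y : 'I_m -> 'M[F]_n) (U V X Y : 'M[F]_n).

Lemma jordan_prodC U X Y : jordan_prod U X Y = jordan_prod U Y X.
Proof. by rewrite /jordan_prod addrC. Qed.

Lemma jordan_prod_suml U x (a : 'I_m -> F) Y :
  jordan_prod U (\sum_k a k *: x k) Y = \sum_k a k *: jordan_prod U (x k) Y.
Proof.
rewrite /jordan_prod !mulmx_suml mulmx_sumr -big_split scaler_sumr /=.
apply: eq_bigr => k _; rewrite -!scalemxAl -scalemxAr -scalerDr.
by rewrite !scalerA mulrC.
Qed.

Lemma jordan_prod_sumr U x (a : 'I_m -> F) Y :
  jordan_prod U Y (\sum_k a k *: x k) = \sum_k a k *: jordan_prod U Y (x k).
Proof.
by rewrite jordan_prodC jordan_prod_suml; under eq_bigr do rewrite jordan_prodC.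
Qed.

Definition family_mx x : 'M[F]_(m, n * n) := \matrix_k mxvec (x k).

Lemma mul_family_mx p (A : 'M[F]_(p, m)) x i :
  row i (A *m family_mx x) = mxvec (\sum_k A i k *: x k).
Proof.
rewrite row_mul mulmx_sum_row linear_sum; apply: eq_bigr => k _.
by rewrite linearZ /= mxE rowK.
Qed.

(** This ties the tensor formula to a change of basis: the columns of p are
the coordinates of the x_k in the family y. *)
Lemma base_changeE U x y (p : 'M[F]_m) c : p \in unitmx ->
    (forall k, x k = \sum_r p r k *: y r) ->
    (forall k l, jordan_prod U (x k) (x l) = \sum_r c r k l *: x r) ->
  forall i j, jordan_prod U (y i) (y j) = \sum_r base_change p c r i j *: y r.
Proof.
move=> up Ex xc i j.
have yE i' : y i' = \sum_k invmx p k i' *: x k.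
  under eq_bigr do rewrite Ex scaler_sumr.
  rewrite exchange_big /= (bigD1 i') //= [X in _ + X]big1 ?addr0 => [|r ri].
    under eq_bigr do rewrite scalerA mulrC.
    rewrite -scaler_suml (_ : \sum_k _ = (p *m invmx p) i' i');
      last by rewrite mxE.
    by rewrite mulmxV // mxE eqxx scale1r.
  under eq_bigr do rewrite scalerA mulrC.
  rewrite -scaler_suml (_ : \sum_k _ = (p *m invmx p) r i');
    last by rewrite mxE.
  by rewrite mulmxV // mxE (negPf ri) scale0r.
rewrite [in LHS](yE i) [in LHS](yE j) jordan_prod_suml.
under eq_bigr => l1 _.
  rewrite jordan_prod_sumr.
  under eq_bigr => l2 _.
    rewrite xc; under eq_bigr do rewrite Ex scaler_sumr.
    over.
  over.
rewrite /base_change.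
under [RHS]eq_bigr => r _.
  rewrite scaler_suml; under eq_bigr => k _.
    rewrite scaler_suml; under eq_bigr => l1 _ do rewrite scaler_suml.
    over.
  rewrite exchange_big /=; under eq_bigr => l1 _ do rewrite exchange_big /=.
  over.
rewrite [RHS]exchange_big /=; apply: eq_bigr => l1 _.
rewrite [RHS]exchange_big /= scaler_sumr; apply: eq_bigr => l2 _.
rewrite [RHS]exchange_big /= !scaler_sumr; apply: eq_bigr => k _.
rewrite !scaler_sumr; apply: eq_bigr => r _; rewrite !scalerA.
by congr (_ *: _); ring.
Qed.

Lemma jordan_prod_congr (T U X Y : 'M[F]_n) : T \in unitmx -> U \in unitmx ->
  jordan_prod (T *m U *m T^T) (T *m X *m T^T) (T *m Y *m T^T) =
  T *m jordan_prod U X Y *m T^T.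
Proof.
move=> uT uU; have uTT : T^T \in unitmx by rewrite unitmx_tr.
rewrite /jordan_prod !invmx_mul ?unitmx_mul ?uT ?uU //.
have E A B : T *m A *m T^T *m (invmx T^T *m (invmx U *m invmx T)) *m (T *m B
  *m T^T)
   = T *m (A *m invmx U *m B) *m T^T.
  by rewrite !mulmxA mulmxK // mulmxKV.
by rewrite !E -scalemxAr -scalemxAl mulmxDr mulmxDl.
Qed.

Definition in_span x X := exists a : 'I_m -> F, X = \sum_k a k *: x k.

Lemma in_spanD x X Y : in_span x X -> in_span x Y -> in_span x (X + Y).
Proof.
move=> [a ->] [b ->]; exists (fun k => a k + b k); rewrite -big_split /=.
by apply: eq_bigr => k _; rewrite scalerDl.
Qed.

Lemma in_spanZ x c X : in_span x X -> in_span x (c *: X).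
Proof.
move=> [a ->]; exists (fun k => c * a k); rewrite scaler_sumr.
by apply: eq_bigr => k _; rewrite scalerA.
Qed.

Lemma in_span_sum x I (r : seq I) (f : I -> 'M[F]_n) :
  (forall i, in_span x (f i)) -> in_span x (\sum_(i <- r) f i).
Proof.
move=> xf; elim/big_rec: _ => [|i X _]; last exact: in_spanD.
by exists (fun=> 0); rewrite big1 // => k _; rewrite scale0r.
Qed.

Lemma in_span_gen x k : in_span x (x k).
Proof.
exists (fun l => (l == k)%:R);
  rewrite (bigD1 k) //= eqxx scale1r big1 ?addr0 //.
by move=> l /negPf ->; rewrite scale0r.
Qed.

Lemma in_span_jordan U x c :
    (forall k l, jordan_prod U (x k) (x l) = \sum_r c r k l *: x r) ->
  forall X Y, in_span x X -> in_span x Y -> in_span x (jordan_prod U X Y).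
Proof.
move=> xc _ _ [a ->] [b ->]; rewrite jordan_prod_suml.
apply: in_span_sum => k; apply: in_spanZ; rewrite jordan_prod_sumr.
apply: in_span_sum => l; apply: in_spanZ; rewrite xc.
apply: in_span_sum => r; apply: in_spanZ; exact: in_span_gen.
Qed.

(** The quadratic operator of W in the Jordan algebra with unit U, which shows
that the left-hand side stays in any Jordan subalgebra that contains W and X. *)
Lemma quadratic_map U W X : (2%:R : F) != 0 ->
  W *m invmx U *m X *m invmx U *m W =
  2 *: jordan_prod U W (jordan_prod U W X) - jordan_prod U (jordan_prod U W W)
    X.
Proof.
move=> two0; rewrite /jordan_prod.
rewrite !(mulmxDl, mulmxDr, scalerDr, =^~ scalemxAl, =^~ scalemxAr, scalerA,
  mulmxA).
set a := W *m _ *m W *m _ *m X; set b := W *m _ *m X *m _ *m W;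
  set d := X *m _ *m W *m _ *m W.
apply/matrixP => i j; rewrite !mxE; field.
by [].
Qed.

(** With S a square root of M = V U^-1 that is a polynomial in M, the matrix
W = S U lies in the Jordan subalgebra spanned by x, because M^k U is a Jordan
power of V.  Symmetry of U and V gives S U = U S^T, so that S U S^T = M U = V,
and S X S^T = W U^-1 X U^-1 W is the quadratic operator of W.  The matrix N is a
right inverse of the coordinates of x, that is, it witnesses that the x_k are
linearly independent. *)
Theorem isotope_isomorphic U V x c (r : seq F) (N : 'M[F]_(n * n, m)) :
    (2%:R : F) != 0 -> U^T = U -> U \in unitmx -> (forall k, (x k)^T = x k) ->
    in_span x U ->
    (forall k l, jordan_prod U (x k) (x l) = \sum_i c i k l *: x i) ->
    family_mx x *m N = 1%:M -> in_span x V -> V \in unitmx ->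
    all (fun b => b != 0) r ->
    char_poly (V *m invmx U) = \prod_(b <- r) ('X - (b ^+ 2)%:P) ->
  exists S A, [/\ S \in unitmx, A \in unitmx, S *m U *m S^T = V &
    forall k, S *m x k *m S^T = \sum_l A l k *: x l].
Proof.
move=> two0 symU uU symx xU xc xN xV uV r0 charM.
have jp_span := in_span_jordan xc.
have symV : V^T = V.
  case: xV => a ->; rewrite linear_sum /=; apply: eq_bigr => k _.
  by rewrite linearZ /= symx.
have [S [SS SD]] := mx_sqrt two0 r0 charM.
set M := V *m invmx U in SS SD charM.
have MU : M *m U = V by rewrite mulmxKV.
have UMT : U *m M^T = V by rewrite trmx_mul trmx_inv symU symV mulKVmx.
(* The properties of the powers of M that pass to S. *)
pose D B := [/\ in_span x (B *m U), B *m U = U *m B^T & B *m M = M *m B].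
have [xSU SU _] : D S.
  apply: SD.
  - split; rewrite ?mul0mx ?mulmx0 ?trmx0 ?mulmx0 //.
    by have := in_spanZ 0 xU; rewrite scale0r.
  - by split; rewrite ?trmx1 ?mulmx1 ?mul1mx.
  - move=> A B [xA A1 A2] [xB B1 B2]; split.
    + by rewrite mulmxDl; exact: in_spanD.
    + by rewrite linearD /= mulmxDl mulmxDr A1 B1.
    + by rewrite mulmxDl mulmxDr A2 B2.
  - move=> a A [xA A1 A2]; split.
    + by rewrite -scalemxAl; exact: in_spanZ.
    + by rewrite linearZ /= -scalemxAl -scalemxAr A1.
    + by rewrite -scalemxAl -scalemxAr A2.
  - move=> A [xA A1 A2]; split; last by rewrite A2 -mulmxA A2.
      have -> : A *m M *m U = jordan_prod U V (A *m U).
        rewrite /jordan_prod mulmxK // mulmxA -/M.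
        have -> : A *m V = M *m A *m U by rewrite -MU mulmxA A2.
        by rewrite -A2 -[_ *m U]scale1r -scalerDl scalerA mulVf // scale1r.
      exact: jp_span.
    by rewrite trmx_mul [RHS]mulmxA UMT -[V in RHS]MU -[RHS]mulmxA -A1 A2
      [RHS]mulmxA.
have uM : M \in unitmx by rewrite unitmx_mul uV unitmx_inv.
have uS : S \in unitmx by move: uM; rewrite -SS unitmx_mul => /andP[].
have Sx k : in_span x (S *m x k *m S^T).
  have -> : S *m x k *m S^T = S *m U *m invmx U *m x k *m invmx U *m (S *m U).
    by rewrite mulmxK // SU mulmxA mulmxKV.
  rewrite quadratic_map // -scaleN1r; apply: in_spanD; apply: in_spanZ.
    by apply: (jp_span) => //; apply: jp_span => //; exact: in_span_gen.
  by apply: (jp_span); [exact: jp_span|exact: in_span_gen].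
pose A := \matrix_(l, k) projT1 (cid (Sx k)) l.
have AE k : S *m x k *m S^T = \sum_l A l k *: x l.
  under eq_bigr do rewrite mxE.
  by case: (cid (Sx k)).
exists S, A; split => //; last by rewrite -mulmxA -SU mulmxA SS.
pose G := lin_mx (mulmxr (invmx S)^T \o mulmx (invmx S)).
have AG : A^T *m family_mx x *m G = family_mx x.
  apply/row_matrixP => k; rewrite row_mul mul_family_mx.
  rewrite (_ : \sum_l _ = S *m x k *m S^T); last first.
    by rewrite AE; apply: eq_bigr => l _; rewrite mxE.
  rewrite mul_vec_lin /= !mulmxA mulVmx //
    mul1mx -mulmxA trmx_inv mulmxV ?unitmx_tr //.
  by rewrite mulmx1 rowK.
rewrite -unitmx_tr; have [|//] := @mulmx1_unit F _ A^T (family_mx x *m G *m N).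
by rewrite !mulmxA AG.
Qed.

End Families.

(** * The place at the origin of the field of rational functions *)

Lemma div_pow_cancel (F : fieldType) (x p q : F) (k l : nat) : q != 0 ->
    x != 0 ->
  p * x ^+ k / (q * x ^+ l) / x ^ (k%:Z - l%:Z) = p / q.
Proof.
move=> q0 x0; rewrite expfzDr // -invr_expz -!exprnP.
have xk0 : x ^+ k != 0 by rewrite expf_neq0.
have xl0 : x ^+ l != 0 by rewrite expf_neq0.
by field; rewrite xk0 q0 xl0.
Qed.

Section RationalFunctions.
Variable C : numFieldType.
Local Notation ratfun := {fraction {poly C}}.
Local Notation tofrac := (@FracField.tofrac {poly C}).

Definition value_at0 (f : ratfun) (c : C) : Prop :=
  exists p q : {poly C}, [/\ q.[0] != 0, f = tofrac p / tofrac q & c = p.[0] /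
    q.[0]].

Lemma poly_unit_part (p : {poly C}) : p != 0 ->
  exists q k, q.[0] != 0 /\ p = q * 'X^k.
Proof.
move=> p0; have [k [q]] := multiplicity_XsubC p 0.
by rewrite p0 subr0 => q0 ->; exists q, k.
Qed.

(** Every nonzero rational function is a power of X times a quotient of
polynomials that do not vanish at 0. *)
Lemma value_at0_place :
  place (tofrac \o polyC) (tofrac 'X) value_at0.
Proof.
have nz (q : {poly C}) : q.[0] != 0 -> tofrac q != 0.
  by move=> q0; rewrite tofrac_eq0; apply: contraNneq q0 => ->; rewrite horner0.
have X0 : tofrac 'X != 0 by rewrite tofrac_eq0 polyX_eq0.
have P1 p : value_at0 (tofrac p) p.[0].
  by exists p, 1; rewrite rmorph1 !divr1 hornerC oner_neq0; split=> //;
    rewrite divr1.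
split.
- split.
  + by move=> c; have := P1 c%:P; rewrite hornerC.
  + move=> _ _ _ _ [p [q [q0 -> ->]]] [p' [q' [q'0 -> ->]]].
    exists (p * q' - p' * q), (q * q'); split;
      first by rewrite hornerM mulf_neq0.
      rewrite rmorphB !rmorphM /= -[X in _ + X]mulNr addf_div ?nz //.
      by rewrite mulNr.
    rewrite hornerD hornerN !hornerM -[X in _ + X]mulNr addf_div //.
    by rewrite mulNr.
  + move=> _ _ _ _ [p [q [q0 -> ->]]] [p' [q' [q'0 -> ->]]].
    exists (p * p'), (q * q'); split; first by rewrite hornerM mulf_neq0.
      by rewrite !rmorphM mulf_div.
    by rewrite !hornerM mulf_div.
  + move=> [p [q [q0 /esym/eqP]]].
    rewrite mulf_eq0 invr_eq0 (negPf (nz _ q0)) orbF tofrac_eq0 => /eqP ->.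
    by rewrite horner0 mul0r => /eqP; rewrite oner_eq0.
- exact: X0.
- by have := P1 'X; rewrite hornerX.
- move=> x; have [p [q [q0 ->]]] := fraction_ex x.
  rewrite mulf_eq0 negb_or tofrac_eq0 => /andP[p0 _].
  have [p1 [k [p10 ->]]] := poly_unit_part p0.
  have [q1 [l [q10 ->]]] := poly_unit_part q0.
  exists (k%:Z - l%:Z), (p1.[0] / q1.[0]); last by rewrite mulf_neq0 ?invr_eq0.
  exists p1, q1; split => //.
  by rewrite !rmorphM !rmorphXn /=; exact: div_pow_cancel (nz _ q10) X0.
Qed.

(** A uniformizer is transcendental over the constants: a polynomial
q X^k with q(0) nonzero takes at s the value q(s) s^k, where q(s) is a unit.
Hence evaluation at s extends to rational functions. *)
Lemma evaluation_morphism (E : fieldType) (iota : {rmorphism C -> E}) s res :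
    place iota s res ->
  exists sigma : {rmorphism ratfun -> E},
    forall p, sigma (ratfun_poly p) = (map_poly iota p).[s].
Proof.
move=> pl; have pp := place_pp pl.
pose ev : {rmorphism {poly C} -> E} := horner_eval s \o map_poly iota.
have ev_inj : injective ev.
  apply: raddf_inj => p evp;
    apply/eqP/negPn/negP => /poly_unit_part[q [k [q0 Ep]]].
  have s00 := res_unif pl.
  have := res_neq0 pp (res_horner q pp s00) q0.
  have evp0 : (map_poly iota p).[s] = 0 := evp.
  move: evp0; rewrite Ep rmorphM /= map_polyXn hornerM hornerXn.
  by move/eqP; rewrite mulf_eq0 expf_eq0 (negPf (unif_neq0 pl)) andbF orbF =>
    ->.
have [sigma sigmaE] := fraction_lift_morphism ev_inj.
by exists sigma => p; exact: sigmaE.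
Qed.

End RationalFunctions.

(** * Degenerating a basis of a Jordan space *)

Section ResJordan.
Variables (C E : fieldType) (iota : {rmorphism C -> E}) (s : E) (res : E -> C
  -> Prop).
Hypothesis pl : place iota s res.
Let pp := place_pp pl.

Lemma res_mxZ n m (a : E) (b : C) (A : 'M[E]_(n, m)) B :
  res a b -> res_mx res A B -> res_mx res (a *: A) (b *: B).
Proof. by move=> ab AB i j; rewrite !mxE; exact: (resM pp). Qed.

Lemma res_mxD n m (A B : 'M[E]_(n, m)) A' B' :
  res_mx res A A' -> res_mx res B B' -> res_mx res (A + B) (A' + B').
Proof. by move=> AA BB i j; rewrite !mxE; exact: (resD pp). Qed.

Lemma res_mx_sum n m (I : Type) (r : seq I) (A : I -> 'M[E]_(n, m)) B :
  (forall i, res_mx res (A i) (B i)) ->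
  res_mx res (\sum_(i <- r) A i) (\sum_(i <- r) B i).
Proof. by move=> AB i j; rewrite !summxE; apply: (res_sum pp) => k _;
  exact: AB. Qed.

Lemma res_jordan_prod n (U X Y : 'M[E]_n) U' X' Y' :
    U' \in unitmx -> res_mx res U U' -> res_mx res X X' -> res_mx res Y Y' ->
  res_mx res (jordan_prod U X Y) (jordan_prod U' X' Y').
Proof.
move=> uU' UU' XX' YY'; have [_ VV'] := res_invmx pl UU' uU'.
have half : res 2^-1 2^-1.
  by have := res_const pp 2^-1; rewrite fmorphV rmorph_nat.
by apply: (res_mxZ half); apply: res_mxD; do 2!apply: (res_mulmx pp) => //.
Qed.

(** The family y is a basis of a lattice, as its reduction is linearly
independent: integral elements of its span have integral coordinates, and these
reduce to the coordinates of the reduction. *)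
Lemma res_coordinates n m (y : 'I_m -> 'M[E]_n)
    (x : 'I_m -> 'M[C]_n) Z Z' d d' :
    (forall i, res_mx res (y i) (x i)) -> row_free (family_mx x) ->
    res_mx res Z Z' -> Z = \sum_r d r *: y r -> Z' = \sum_r d' r *: x r ->
  forall r, res (d r) (d' r).
Proof.
move=> yx fx ZZ' EZ EZ' r.
set N := pinvmx (family_mx x).
have xN : family_mx x *m N = 1%:M by exact: mulmxVp.
have rv (A : 'M[E]_n) B : res_mx res A B -> res_mx res (mxvec A) (mxvec B).
  by move=> AB i k; case/mxvec_indexP: k => a b; rewrite ord1 !mxvecE;
    exact: AB.
have ry : res_mx res (family_mx y) (family_mx x).
  by move=> i k; rewrite !mxE; exact: rv.
have rG := res_mulmx pp ry (res_mx_const pp N); rewrite xN in rG.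
have [uG rGV] := res_invmx pl rG (unitmx1 _ _).
have coord (F : fieldType) (w : 'I_m -> 'M[F]_n) (a : 'I_m -> F) :
    (\row_k a k) *m family_mx w = mxvec (\sum_k a k *: w k).
  rewrite -[LHS](row_id ord0) mul_family_mx; congr mxvec.
  by apply: eq_bigr => k _; rewrite mxE.
have := res_mulmx pp (res_mulmx pp (rv _ _ ZZ') (res_mx_const pp N)) rGV.
rewrite EZ EZ' -!coord -(mulmxA _ (family_mx y)) (mulmxK uG).
rewrite -(mulmxA _ (family_mx x)) xN invmx1 !mulmx1.
by move=> /(_ ord0 r); rewrite !mxE.
Qed.

End ResJordan.

Section Core.
Variables (C : numFieldType) (E : fieldType) (iota : {rmorphism C -> E}).
Variables (s : E) (res : E -> C -> Prop).
Hypothesis pl : place iota s res.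
Let pp := place_pp pl.
Local Notation ratfun := {fraction {poly C}}.

Lemma laurent_base_change m (g : 'M[ratfun]_m)
    (c : 'I_m -> 'I_m -> 'I_m -> C) i j1 j2 :
  laurent_GL g ->
  laurent (base_change g (fun k l1 l2 => ratfun_const (c k l1 l2)) i j1 j2).
Proof.
move=> [_ Lg LgV]; do 3!apply: laurent_sum => ? _.
apply: laurentM; last exact: LgV.
apply: laurentM; last exact: LgV.
apply: laurentM; first exact: Lg.
exact: laurent_poly.
Qed.

Lemma map_base_change (F : fieldType) (f : {rmorphism ratfun -> F}) m
    (g : 'M[ratfun]_m) c i j1 j2 :
  f (base_change g c i j1 j2) =
  base_change (map_mx f g) (fun k l1 l2 => f (c k l1 l2)) i j1 j2.
Proof.
rewrite /base_change rmorph_sum; apply: eq_bigr => k _.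
rewrite rmorph_sum; apply: eq_bigr => l1 _.
rewrite rmorph_sum; apply: eq_bigr => l2 _.
by rewrite !rmorphM -map_invmx !mxE.
Qed.

(** The heart of the argument, over an extension where the eigenvalues of
V U^-1 are squares; here p and q play the roles of P and Q. *)
Lemma family_degenerates n m (X X' : 'I_m -> 'M[C]_n) (U U' : 'M[C]_n)
    (c c' : 'I_m -> 'I_m -> 'I_m -> C) (u' : 'I_m -> C)
    (p : 'M[E]_n) (q : 'M[E]_m) (r : seq E) :
  let x k := map_mx iota (X k) in
  let y i := \sum_k q k i *: (p *m x k *m p^T) in
  let V := \sum_i iota (u' i) *: \sum_k q k i *: x k in
    U^T = U -> U \in unitmx -> (forall k, (X k)^T = X k) -> in_span X U ->
    (forall k l, jordan_prod U (X k) (X l) = \sum_i c i k l *: X i) ->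
    row_free (family_mx X) ->
    U' \in unitmx -> U' = \sum_i u' i *: X' i ->
    (forall k l, jordan_prod U' (X' k) (X' l) = \sum_i c' i k l *: X' i) ->
    row_free (family_mx X') ->
    p \in unitmx -> q \in unitmx -> (forall i, res_mx res (y i) (X' i)) ->
    char_poly (V *m invmx (map_mx iota U)) = \prod_(b <- r) ('X - (b ^+ 2)%:P)
      ->
  structure_degenerates c c'.
Proof.
move=> x y V symU uU symX XU Xc fX uU' EU' Xc' fX' up uq yX' charM.
have two0 : (2%:R : E) != 0 by rewrite -(rmorph_nat iota) fmorph_eq0 pnatr_eq0.
set UE := map_mx iota U in charM *.
have uUE : UE \in unitmx by rewrite map_unitmx.
have jx (a : 'I_m -> C) : map_mx iota (\sum_k a k *: X k) =
    \sum_k iota (a k) *: x k.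
  by rewrite raddf_sum; apply: eq_bigr => k _; rewrite /= map_mxZ.
(* The unit of the family y, which reduces to U'. *)
pose V0 := \sum_i iota (u' i) *: y i.
have V0E : V0 = p *m V *m p^T.
  rewrite /V0 /V mulmx_sumr mulmx_suml; apply: eq_bigr => i _.
  rewrite -scalemxAr -scalemxAl mulmx_sumr mulmx_suml; congr (_ *: _).
  by apply: eq_bigr => k _; rewrite -scalemxAr -scalemxAl.
have rV0 : res_mx res V0 U'.
  rewrite EU'; apply: (res_mx_sum pl) => i; apply: (res_mxZ pl) => //.
  exact: (res_const pp).
have [uV0 _] := res_invmx pl rV0 uU'.
have uV : V \in unitmx by move: uV0; rewrite V0E !unitmx_mul => /andP[/andP[]].
have r0 : all (fun b => b != 0) r.
  apply/allP => b br; apply: contraTneq isT => b0.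
  have : (char_poly (V *m invmx UE)).[0] == 0.
    rewrite charM horner_prod prodf_seq_eq0; apply/hasP; exists b => //=.
    by rewrite b0 expr0n subr0 hornerX.
  rewrite horner_coef0 char_poly_det mulf_eq0 signr_eq0 /= => /eqP d0.
  have : V *m invmx UE \in unitmx by rewrite unitmx_mul uV unitmx_inv.
  by rewrite unitmxE d0 unitr0.
have [S [A [uS uA SUS SxS]]] :
  exists S A, [/\ S \in unitmx, A \in unitmx, S *m UE *m S^T = V &
    forall k, S *m x k *m S^T = \sum_l A l k *: x l].
  apply: (@isotope_isomorphic E n m UE V x (fun i k l => iota (c i k l)) r
            (map_mx iota (pinvmx (family_mx X)))) => //.
  - by rewrite map_trmx symU.
  - by move=> k; rewrite map_trmx symX.
  - by case: XU => a Ea; exists (fun k => iota (a k)); rewrite -jx -Ea.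
  - move=> k l; rewrite -jx -Xc /jordan_prod map_mxZ fmorphV rmorph_nat.
    by rewrite map_mxD !map_mxM map_invmx.
  - have -> : family_mx x = map_mx iota (family_mx X).
      apply/matrixP => i k; rewrite !mxE; case/mxvec_indexP: k => a b.
      by rewrite !mxvecE mxE.
    by rewrite -map_mxM mulmxVp // map_mx1.
  - apply: in_span_sum => i; apply: in_spanZ; apply: in_span_sum => k.
    by apply: in_spanZ; exact: in_span_gen.
pose T := p *m S; have uT : T \in unitmx by rewrite unitmx_mul up.
have TUT : T *m UE *m T^T = V0.
  by rewrite V0E -SUS /T trmx_mul !mulmxA.
pose h := invmx q *m A;
  have uh : h \in unitmx by rewrite unitmx_mul unitmx_inv uq.
(* The structure constants of z for the unit V0 are those of A. *)
pose z k := T *m x k *m T^T.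
have zE k : z k = \sum_i h i k *: y i.
  have -> : z k = \sum_l A l k *: (p *m x l *m p^T).
    have -> : z k = p *m (S *m x k *m S^T) *m p^T by rewrite /z /T trmx_mul
      !mulmxA.
    rewrite SxS mulmx_sumr mulmx_suml; apply: eq_bigr => l _.
    by rewrite -scalemxAr -scalemxAl.
  under [RHS]eq_bigr => i _ do rewrite /y scaler_sumr.
  rewrite [RHS]exchange_big /=; apply: eq_bigr => l _.
  under eq_bigr do rewrite scalerA mulrC; rewrite -scaler_suml; congr (_ *: _).
  by rewrite -[A in LHS](mulKVmx uq) mxE.
have [sigma sigmaE] := evaluation_morphism pl.
have [g [k [Lg hE k1]]] := laurent_decomposition pl sigmaE uh.
exists g; split; first exact Lg.
(* The basis y corrected by the integral factor k; it reduces to the same X'. *)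
pose y' r := \sum_i k i r *: y i.
have ry' i : res_mx res (y' i) (X' i).
  have -> : X' i = \sum_l (1%:M : 'M[C]_m) l i *: X' l.
    rewrite (bigD1 i) //= mxE eqxx scale1r big1 ?addr0 // => l li.
    by rewrite mxE (negPf li) scale0r.
  by apply: (res_mx_sum pl) => l; apply: (res_mxZ pl).
have zE' l : z l = \sum_r map_mx sigma g r l *: y' r.
  rewrite zE; under [RHS]eq_bigr => i _ do rewrite /y' scaler_sumr.
  rewrite [RHS]exchange_big /=; apply: eq_bigr => i _.
  under eq_bigr do rewrite scalerA mulrC; rewrite -scaler_suml; congr (_ *: _).
  by rewrite hE mxE.
have usg : map_mx sigma g \in unitmx.
  by move: uh; rewrite hE unitmx_mul => /andP[].
have zc k' l : jordan_prod V0 (z k') (z l) = \sum_i iota (c i k' l) *: z i.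
  rewrite -TUT jordan_prod_congr //.
  have -> : jordan_prod UE (x k') (x l) = \sum_i iota (c i k' l) *: x i.
    rewrite -jx -Xc /jordan_prod map_mxZ fmorphV rmorph_nat.
    by rewrite map_mxD !map_mxM map_invmx.
  rewrite mulmx_sumr mulmx_suml; apply: eq_bigr => i _.
  by rewrite -scalemxAr -scalemxAl.
have y'c := base_changeE usg zE' zc.
move=> i j1 j2; apply: (laurent_cvg0_of_res pl sigmaE).
  exact: laurent_base_change Lg.
rewrite map_base_change.
have -> : (fun k0 l1 l2 => sigma (ratfun_const (c k0 l1 l2))) =
    (fun k0 l1 l2 => iota (c k0 l1 l2)).
  by apply/funext => ?; apply/funext => ?; apply/funext => ?;
    rewrite (sigma_const sigmaE).
exact: (res_coordinates pl ry' fX' (res_jordan_prod pl uU' rV0 (ry' j1) (ry'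
  j2)) (y'c j1 j2) (Xc' j1 j2)).
Qed.

End Core.

(** * From Jordan spaces to abstract Jordan algebras *)

Lemma free_family (F : fieldType) n m (X : m.-tuple 'M[F]_n) :
  free X -> row_free (family_mx (tnth X)).
Proof.
move=> /freeP fX; rewrite -kermx_eq0; apply/rowV0P => v /sub_kermxP vX.
apply/rowP => k; rewrite mxE; apply: fX.
transitivity (\sum_i v ord0 i *: tnth X i).
  by apply: eq_bigr => i _; rewrite (tnth_nth 0).
have := congr1 (row ord0) vX; rewrite mul_family_mx row0 => /eqP.
by rewrite mxvec_eq0 => /eqP.
Qed.

(** A basis of an embedding is the image of a basis of the algebra, and the
structure constants of the algebra are those of the matrix product. *)
Lemma embedding_family (F : numFieldType) n m (A : jordanType F)
    (L : {vspace 'M[F]_n}) (X : m.-tuple 'M[F]_n) :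
    jordan_embedding A L -> basis_of L X ->
  exists (U : 'M[F]_n) (x : m.-tuple A),
    [/\ [/\ U^T = U, U \in unitmx & forall k, (tnth X k)^T = tnth X k],
        in_span (tnth X) U, basis_of fullv x,
        row_free (family_mx (tnth X)) &
        forall k l, jordan_prod U (tnth X k) (tnth X l) =
          \sum_i structure_constants x i k l *: tnth X i].
Proof.
move=> [U [phi [[symU uU] /eqP kphi [symphi phi1] phiM EL]]] bX.
have XL k : tnth X k \in limg phi by rewrite -EL (basis_mem bX) // mem_tnth.
have [x phix] : exists x : m.-tuple A, forall k, phi (tnth x k) = tnth X k.
  exists [tuple (phi^-1)%VF (tnth X k) | k < m] => k.
  by rewrite tnth_mktuple limg_lfunVK.
have phi_sum (a : 'I_m -> F) : phi (\sum_k a k *: tnth x k) =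
    \sum_k a k *: tnth X k.
  by rewrite linear_sum; apply: eq_bigr => k _; rewrite linearZ /= phix.
have bx : basis_of fullv x.
  rewrite basisEfree subvf size_tuple /=; apply/andP; split.
    apply/freeP => a a0; have /freeP := basis_free bX; apply.
    transitivity (phi (\sum_i a i *: tnth x i)).
      by rewrite phi_sum; apply: eq_bigr => i _; rewrite (tnth_nth 0).
    suff -> : \sum_i a i *: tnth x i = 0 by rewrite linear0.
    rewrite -[RHS]a0.
    by apply: eq_bigr => i _; rewrite (tnth_nth 0).
  rewrite -[m in (_ <= m)%N](size_basis bX) EL limg_dim_eq //.
  by rewrite kphi capv0.
have xE v : v = \sum_k coord x k v *: tnth x k.
  rewrite {1}(coord_basis bx (memvf v)).
  by apply: eq_bigr => i _; rewrite (tnth_nth 0).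
exists U, x; split => //.
- by split => // k; rewrite -phix.
- by exists (fun k => coord x k jone); rewrite -phi_sum -xE phi1.
- exact/free_family/basis_free/bX.
- move=> k l; rewrite -!phix -phiM [jmul _ _]xE phi_sum.
  by apply: eq_bigr => i _.
Qed.

(** The place t = 0 of C(t) is extended until the characteristic polynomial
of V U^-1 splits; being integral with residues X' at t = 0, the family Y keeps
these properties at the extended place. *)
Theorem space_degeneration_algebra_degeneration (C : numClosedFieldType)
    (n m : nat)
    (L L' : {vspace 'M[C]_n}) (A A' : jordanType C) :
    jordan_embedding A L -> jordan_embedding A' L' ->
    jordan_space_degenerates m L L' ->
  jordan_algebra_degenerates m A A'.
Proof.
move=> eA eA' [X [X' [bX bX' [P [Q [LP LQ lim]]]]]].
have [U [x [[symU uU symX] XU bx fX Xc]]] := embedding_family eA bX.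
have [U' [x' [[_ uU' _] [u' EU'] bx' fX' Xc']]] := embedding_family eA' bX'.
exists x, x'; split; [exact: bx|exact: bx'|].
pose K : fieldType := {fraction {poly C}}.
pose iota : {rmorphism C -> K} := @FracField.tofrac {poly C} \o polyC.
have pl : place iota (ratfun_poly 'X) (@value_at0 C) := value_at0_place C.
pose XK k := map_mx iota (tnth X k).
pose V : 'M[K]_n := \sum_i iota (u' i) *: \sum_k Q k i *: XK k.
have [E [j [s [res [r [plE ext char_r]]]]]] :=
  square_splitting pl (char_poly_monic (V *m invmx (map_mx iota U))).
have jiota a b (B : 'M[C]_(a, b)) : map_mx j (map_mx iota B) =
    map_mx (j \o iota) B.
  by rewrite map_mx_comp.
have [uP _ _] := LP; have [uQ _ _] := LQ.
apply: (family_degenerates plE (p := map_mx j P) (q := map_mx j Q) (r := r)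
  symU uU symX XU Xc fX uU' EU' Xc' fX').
- by rewrite map_unitmx; exact uP.
- by rewrite map_unitmx; exact uQ.
- move=> i.
  have -> : \sum_k map_mx j Q k i *:
      (map_mx j P *m map_mx (j \o iota) (tnth X k) *m (map_mx j P)^T) =
    map_mx j (\sum_k Q k i *: (P *m XK k *m P^T)).
    rewrite raddf_sum; apply: eq_bigr => k _.
    by rewrite /= map_mxZ !map_mxM map_trmx jiota mxE.
  move=> a b; rewrite mxE; apply: ext.
  have [[f Ef] lf] := lim i a b.
  rewrite Ef in lf; rewrite (laurent_cvg0_polyE lf).
  suff -> : (\sum_k Q k i *: (P *m XK k *m P^T)) a b = ratfun_poly f.
    exists f, 1; split; first by rewrite hornerC oner_neq0.
      by rewrite tofrac1 divr1.
    by rewrite hornerC divr1.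
  exact Ef.
- set VE := \sum_i _ in |- *.
  have VjE : map_mx j V = VE.
    rewrite /V raddf_sum; apply: eq_bigr => i _; rewrite /= map_mxZ.
    congr (_ *: _); rewrite raddf_sum; apply: eq_bigr => k _.
    by rewrite /= map_mxZ mxE jiota.
  by rewrite -char_r map_char_poly map_mxM map_invmx jiota VjE.
Qed.

Local Open Scope complex_scope.

Theorem proposition6p1 (R : realType) (n m : nat)
    (L L' : {vspace 'M[R[i]]_n}) (A A' : jordanType R[i])
    (dimL : \dim L = m) (dimL' : \dim L' = m)
    (embL : jordan_embedding A L) (embL' : jordan_embedding A' L')
    (degL : jordan_space_degenerates m L L') :
  jordan_algebra_degenerates m A A'.
Proof.
exact: (@space_degeneration_algebra_degeneration R[i] n m L L' A A' embL embL'
  degL).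
Qed.
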